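(* Let $\mu\in\mathcal M$ be such that $\mu(\{a\})>0$, $\mu([b,\infty))>0$ and $\mu(\{a\})+\mu([b,\infty))=1$, where $a<b$ are real numbers, and $\lim_{x\uparrow b}G_\mu(x)=0$. Then $\mu$ is an indecomposable probability measure in $(\mathcal M,\boxplus)$.
   Context: $\mathcal M$ is the set of Borel probability measures on $\mathbb R$, $\mathbb C^+$ the open upper half-plane. $G_\mu(z)=\int_{\mathbb R}\frac{\mu(dt)}{z-t}$ is the Cauchy transform (defined by the same integral for real $x\in(a,b)$), $F_\mu=1/G_\mu$ on $\mathbb C^+$, and $\mathcal F=\{F_\mu:\mu\in\mathcal M\}$. Given $\mu_1,\mu_2\in\mathcal M$ there are unique $Z_1,Z_2\in\mathcal F$ with $z=Z_1(z)+Z_2(z)-F_{\mu_1}(Z_1(z))$ and $F_{\mu_1}(Z_1(z))=F_{\mu_2}(Z_2(z))$ on $\mathbb C^+$; the free additive convolution $\mu_1\boxplus\mu_2$ is the measure in $\mathcal M$ with $F_{\mu_1\boxplus\mu_2}(z)=F_{\mu_1}(Z_1(z))$. $\mu_1\in\mathcal M$ is a factor of $\mu$ if $\mu=\mu_1\boxplus\mu_2$ for some $\mu_2\in\mathcal M$; the improper factors of $\mu$ are $\delta_c$ and $\mu\boxplus\delta_c$, $c\in\mathbb R$ ($\delta_c$ the Dirac measure at $c$). $\mu$ is indecomposable if it is not a Dirac measure and has improper factors only. *)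

(* Defs.v *)
From HB Require Import structures.
From mathcomp Require Import all_boot all_order all_algebra.
From mathcomp Require Import all_classical all_reals all_analysis.
From mathcomp Require Export complex.

Set Implicit Arguments.
Unset Strict Implicit.
Unset Printing Implicit Defensive.

Import Order.TTheory GRing.Theory Num.Theory.
Import numFieldNormedType.Exports.

Local Open Scope classical_set_scope.
Local Open Scope ring_scope.
Local Open Scope complex_scope.

Notation borel_prob R := (probability (measurableTypeR R) R).

(* Measures are total functions on [set R]; only their values on Borel sets
   are meaningful. *)
Definition same_law (R : realType) (mu nu : borel_prob R) : Prop :=
  forall A : set (measurableTypeR R), measurable A -> mu A = nu A.

Definition dirac_law (R : realType) (c : R) : borel_prob R :=
  @dirac _ (measurableTypeR R) c R.

(* [\int[mu]_t f t] is real-valued, so the integral of the complex function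
   1 / (z - t) is taken on its real and imaginary parts. *)
Definition cauchy_transform (R : realType) (mu : borel_prob R) (z : R[i]) :
    R[i] :=
  (\int[mu]_t complex.Re ((z - t%:C)^-1)) +i* (\int[mu]_t complex.Im ((z - t%:C)^-1)).

Definition real_cauchy_transform (R : realType) (mu : borel_prob R) (x : R) :
    R :=
  \int[mu]_t (x - t)^-1.

Lemma cauchy_transform_real (R : realType) (mu : borel_prob R) (x : R) :
  cauchy_transform mu x%:C = (real_cauchy_transform mu x)%:C.
Proof.
have E (t : R) : (x%:C - t%:C)^-1 = ((x - t)^-1)%:C by rewrite fmorphV rmorphB.
rewrite /cauchy_transform /real_cauchy_transform /real_complex_def.
congr (_ +i* _); first by apply: eq_Rintegral => t _; rewrite E.
rewrite (@eq_Rintegral _ _ _ mu _ (cst 0)); last by move=> t _; rewrite E.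
by rewrite /Rintegral integral0.
Qed.

Definition upper_half_plane (R : realType) : set R[i] := [set z | 0 < complex.Im z].

Definition recip_cauchy (R : realType) (mu : borel_prob R) (z : R[i]) : R[i] :=
  (cauchy_transform mu z)^-1.

(* Elements of the class are functions on the upper half-plane, here
   represented by total functions whose other values are irrelevant. *)
Definition recip_cauchy_class (R : realType) : set (R[i] -> R[i]) :=
  [set Z | exists nu : borel_prob R,
     forall z, upper_half_plane z -> Z z = recip_cauchy nu z].

(* [is_free_conv mu1 mu2 mu] is the graph of free additive convolution: it
   says that mu is the free additive convolution of mu1 and mu2. *)
Definition is_free_conv (R : realType) (mu1 mu2 mu : borel_prob R) : Prop :=
  exists Z1 Z2 : R[i] -> R[i],
    [/\ recip_cauchy_class Z1, recip_cauchy_class Z2 &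
      forall z, upper_half_plane z ->
        [/\ z = Z1 z + Z2 z - recip_cauchy mu1 (Z1 z),
            recip_cauchy mu1 (Z1 z) = recip_cauchy mu2 (Z2 z) &
            recip_cauchy mu z = recip_cauchy mu1 (Z1 z)]].

Definition is_factor (R : realType) (mu1 mu : borel_prob R) : Prop :=
  exists mu2 : borel_prob R, is_free_conv mu1 mu2 mu.

Definition is_improper_factor (R : realType) (nu mu : borel_prob R) : Prop :=
  exists c : R,
    same_law nu (dirac_law c) \/ is_free_conv mu (dirac_law c) nu.

Definition is_dirac (R : realType) (mu : borel_prob R) : Prop :=
  exists c : R, same_law mu (dirac_law c).

Definition indecomposable (R : realType) (mu : borel_prob R) : Prop :=
  ~ is_dirac mu /\
  forall nu : borel_prob R, is_factor nu mu -> is_improper_factor nu mu.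

(* Main.v *)
Require Import Defs.
From HB Require Import structures.
From mathcomp Require Import all_boot all_order all_algebra.
From mathcomp Require Import all_classical all_reals all_analysis.
From mathcomp Require Import measurable_realfun ring lra.
Import Order.TTheory GRing.Theory Num.Theory.
Import numFieldNormedType.Exports.

Local Open Scope classical_set_scope.
Local Open Scope ring_scope.

(** Write G for the Cauchy transform of mu and F = 1/G.  The hypotheses say that
    mu has an atom at a, no other mass below b, and that G decreases to 0 as
    x increases to b.  Hence F is real analytic on the half-line below b and maps
    it increasingly onto the whole real line: the pole of G at the atom is a
    harmless zero of F, and F tends to infinity at b.

    Let mu be the free convolution of mu1 and mu2, with subordination functions
    Z1 and Z2, so that F(z) + z = Z1(z) + Z2(z) and F = F1(Z1) = F2(Z2).  Since
    Im Z >= Im z for each of them, Im Z1 and Im Z2 are at most Im F, which is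
    O(Im z) on every half-plane Re z <= x2 with x2 < b ([im_recip_le]).  By
    the Schwarz-Pick inequality Z1 and Z2 are therefore Lipschitz there
    ([re_recip_lipschitz]), up to the real line, and take real boundary values.
    Their sum tends to infinity at b, so the boundary values of one of them, say
    Z1, are unbounded near b ([unbounded_summand]); at minus infinity those of Z1
    tend to minus infinity ([re_recip_left]).  By the intermediate value theorem
    every real w is a boundary value Z1(x) with x < b, and unless w = Z1(a)
    the identity G1(Z1) = G bounds the Poisson integral of mu1 near w, so that
    mu1 has no mass near w.  Thus mu1 is the Dirac measure at Z1(a)
    ([subordinated_dirac]).  The argument runs on horizontal segments at small
    height, where the real intermediate value theorem applies to Re Z1.

    If Z2 is the unbounded one, then mu2 is a Dirac measure at some c and mu1 is
    the translate of mu by - c.  To see that this is an improper factor one must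
    exhibit the subordination functions of mu and the Dirac measure at - c, and
    one of them is the reciprocal transform of mu1 minus the constant c.  That
    this function is again a reciprocal Cauchy transform is
    [boolean_shift_exists].  For a finitely supported measure it is a statement
    about rank-one perturbations: if G is the resolvent entry of a diagonal
    matrix D at a unit vector v, then G/(1 - cG) is that of D + c v v^T, and the
    spectral theorem gives the new measure ([rank_one_perturbation]).  The
    general case follows by weak compactness ([tight_subsequence]), proved with
    quantile functions, whose convergence almost everywhere along a subsequence
    turns weak convergence into dominated convergence.

    Complex numbers are split into real and imaginary parts: the transform of nu
    at x + iy, for y > 0, is [mean_re nu x y - i * mean_im nu x y], its
    reciprocal is [re_recip nu x y + i * im_recip nu x y]. *)

Set Implicit Arguments.
Unset Strict Implicit.

(** * Integrals of bounded functions and the Cauchy kernels *)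

Section bounded_functions.
Context {R : realType}.
Implicit Types (nu : borel_prob R) (f g : R -> R).

Definition bounded_meas f :=
  measurable_fun [set: R] f /\ exists M : R, forall t, `|f t| <= M.

Lemma bounded_meas_integrable nu f :
  bounded_meas f -> nu.-integrable setT (EFin \o f).
Proof.
move=> [mf [M fM]]; apply: measurable_bounded_integrable => //.
  by rewrite (le_lt_trans (probability_le1 nu measurableT))// ltry.
exists M; split; first exact: num_real.
by move=> N MN t _ /=; exact: le_trans (fM t) (ltW MN).
Qed.

Lemma bounded_meas_cst (c : R) : bounded_meas (fun=> c).
Proof. by split; [exact: measurable_cst | exists `|c|]. Qed.

Lemma bounded_measD f g :
  bounded_meas f -> bounded_meas g -> bounded_meas (fun t => f t + g t).
Proof.
move=> [mf [M fM]] [mg [N gN]]; split; first exact: measurable_funD.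
by exists (M + N) => t; apply: le_trans (ler_normD _ _) _; exact: lerD.
Qed.

Lemma bounded_measM f g :
  bounded_meas f -> bounded_meas g -> bounded_meas (fun t => f t * g t).
Proof.
move=> [mf [M fM]] [mg [N gN]]; split; first exact: measurable_funM.
by exists (M * N) => t; rewrite normrM; exact: ler_pM.
Qed.

Lemma bounded_measZ (c : R) f :
  bounded_meas f -> bounded_meas (fun t => c * f t).
Proof. by move=> bf; apply: bounded_measM => //; exact: bounded_meas_cst. Qed.

Lemma bounded_measB f g :
  bounded_meas f -> bounded_meas g -> bounded_meas (fun t => f t - g t).
Proof.
move=> bf bg; have := bounded_measD bf (bounded_measZ (-1) bg).
by congr bounded_meas; apply/funext => t; rewrite mulN1r.
Qed.

Lemma mean_cst nu (c : R) : \int[nu]_t c = c.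
Proof.
rewrite Rintegral_cst// (_ : fine _ = 1) ?mulr1//.
by have /= -> := @probability_setT _ _ _ nu.
Qed.

Lemma meanD nu f g : bounded_meas f -> bounded_meas g ->
  \int[nu]_t (f t + g t) = \int[nu]_t f t + \int[nu]_t g t.
Proof. by move=> bf bg; rewrite RintegralD//; exact: bounded_meas_integrable. Qed.

Lemma meanB nu f g : bounded_meas f -> bounded_meas g ->
  \int[nu]_t (f t - g t) = \int[nu]_t f t - \int[nu]_t g t.
Proof. by move=> bf bg; rewrite RintegralB//; exact: bounded_meas_integrable. Qed.

Lemma meanZ nu (c : R) f : bounded_meas f ->
  \int[nu]_t (c * f t) = c * \int[nu]_t f t.
Proof. by move=> bf; rewrite RintegralZl//; exact: bounded_meas_integrable. Qed.

Lemma mean_le nu f g : bounded_meas f -> bounded_meas g ->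
  (forall t, f t <= g t) -> \int[nu]_t f t <= \int[nu]_t g t.
Proof.
by move=> bf bg fg; apply: le_Rintegral => //; exact: bounded_meas_integrable.
Qed.

Lemma mean_le_ae nu (S : set (measurableTypeR R)) f g : measurable S -> nu S = 1%E ->
  bounded_meas f -> bounded_meas g ->
  (forall t, S t -> f t <= g t) -> \int[nu]_t f t <= \int[nu]_t g t.
Proof.
move=> mS S1 bf bg fg.
have nS : nu (~` S) = 0%E by rewrite probability_setC// S1 subee.
have restr h : bounded_meas h -> \int[nu]_t h t = \int[nu]_(t in S) h t.
  move=> bh; rewrite /Rintegral (negligible_integral (measurableC mS)) ?setTD ?setCK//.
  exact: bounded_meas_integrable.
rewrite (restr _ bf) (restr _ bg).
apply: le_Rintegral => //.
  by apply: integrableS (bounded_meas_integrable _ bf).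
by apply: integrableS (bounded_meas_integrable _ bg).
Qed.

End bounded_functions.

Section cauchy_kernels.
Context {R : realType}.
Implicit Types (nu : borel_prob R) (x y t : R).

Definition sqdist x y t : R := (x - t) ^+ 2 + y ^+ 2.

Definition re_kernel x y t : R := (x - t) / sqdist x y t.
Definition im_kernel x y t : R := y / sqdist x y t.
Definition poisson_kernel x y t : R := (sqdist x y t)^-1.

Lemma sqdist_gt0 x y t : 0 < y -> 0 < sqdist x y t.
Proof. by move=> y0; rewrite /sqdist ltr_wpDl ?sqr_ge0// exprn_gt0. Qed.

Lemma sqdist_ge x y t : 0 < y -> y ^+ 2 <= sqdist x y t.
Proof. by move=> y0; rewrite /sqdist lerDr sqr_ge0. Qed.

Lemma continuous_sqdist x y : continuous (sqdist x y).
Proof.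
have cB : continuous (fun t : R => x - t).
  by move=> t; apply: cvgB; first exact: cvg_cst.
rewrite (_ : sqdist x y = fun t => (x - t) * (x - t) + y ^+ 2)//.
by move=> t; apply: cvgD; first (by apply: cvgM; exact: cB); exact: cvg_cst.
Qed.

Lemma continuous_poisson_kernel x y : 0 < y -> continuous (poisson_kernel x y).
Proof.
move=> y0 t; apply: cvgV; first by rewrite gt_eqF// sqdist_gt0.
exact: continuous_sqdist.
Qed.

Lemma bounded_poisson_kernel x y : 0 < y -> bounded_meas (poisson_kernel x y).
Proof.
move=> y0; split.
  by apply: continuous_measurable_fun; exact: continuous_poisson_kernel.
exists (y ^+ 2)^-1 => t.
have d0 := sqdist_gt0 x t y0.
rewrite /poisson_kernel gtr0_norm ?invr_gt0//.
by rewrite lef_pV2 ?posrE ?sqdist_gt0 ?exprn_gt0// sqdist_ge.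
Qed.

Lemma continuous_im_kernel x y : 0 < y -> continuous (im_kernel x y).
Proof.
by move=> y0 t; apply: cvgM; [exact: cvg_cst|exact: continuous_poisson_kernel].
Qed.

Lemma continuous_re_kernel x y : 0 < y -> continuous (re_kernel x y).
Proof.
move=> y0 t; apply: cvgM; last exact: continuous_poisson_kernel.
by apply: cvgB; first exact: cvg_cst.
Qed.

Lemma bounded_im_kernel x y : 0 < y -> bounded_meas (im_kernel x y).
Proof. by move=> y0; apply/bounded_measZ/bounded_poisson_kernel. Qed.

Lemma bounded_re_kernel x y : 0 < y -> bounded_meas (re_kernel x y).
Proof.
move=> y0; split.
  by apply: continuous_measurable_fun; exact: continuous_re_kernel.
exists y^-1 => t; rewrite /re_kernel normrM normfV (gtr0_norm (sqdist_gt0 x t y0)).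
rewrite ler_pdivrMr ?sqdist_gt0//.
rewrite -(ler_pM2l y0) mulrA divff ?gt_eqF// mul1r.
rewrite /sqdist -(real_normK (num_real (x - t))).
set u := `|_|; have := sqr_ge0 (u - y); have : 0 <= u by exact: normr_ge0.
nra.
Qed.

(** The sign makes [mean_im] positive: it is minus the imaginary part of the
    Cauchy transform. *)
Definition mean_re nu x y : R := \int[nu]_t re_kernel x y t.
Definition mean_im nu x y : R := \int[nu]_t im_kernel x y t.
Definition mean_poisson nu x y : R := \int[nu]_t poisson_kernel x y t.

Lemma mean_imE nu x y : 0 < y -> mean_im nu x y = y * mean_poisson nu x y.
Proof. by move=> y0; rewrite -meanZ//; exact: bounded_poisson_kernel. Qed.

Lemma mean_poisson_gt0 nu x y : 0 < y -> 0 < mean_poisson nu x y.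
Proof.
move=> y0; rewrite lt_neqAle; apply/andP; split; last first.
  by apply: Rintegral_ge0 => t _; rewrite invr_ge0 ltW// sqdist_gt0.
apply/eqP => e0.
have := bounded_meas_integrable nu (bounded_poisson_kernel x y0).
move=> /integrableP[mf _].
have fin := integrable_fin_num measurableT
  (bounded_meas_integrable nu (bounded_poisson_kernel x y0)).
have i0 : (\int[nu]_t (poisson_kernel x y t)%:E = 0)%E.
  by rewrite -(fineK fin); congr (_%:E).
have : (\int[nu]_t `|(poisson_kernel x y t)%:E| = 0)%E.
  rewrite -[RHS]i0; apply: eq_integral => t _.
  by rewrite gee0_abs// lee_fin invr_ge0 ltW// sqdist_gt0.
move/(ae_eq_integral_abs _ measurableT mf).1 => -[N [mN N0 subN]].
have NT : N = setT.
  rewrite -subTset => t _; apply: subN => /(_ I) /=.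
  by case=> /eqP; rewrite invr_eq0 gt_eqF// sqdist_gt0.
move: N0; rewrite NT.
have /= -> := @probability_setT _ _ _ nu.
by move/eqP; rewrite onee_eq0.
Qed.


End cauchy_kernels.

(** * The reciprocal Cauchy transform and the Schwarz-Pick inequality *)

Section reciprocal_cauchy.
Context {R : realType}.
Implicit Types (nu : borel_prob R) (x y t : R).

Definition abs2_cauchy nu x y : R := mean_re nu x y ^+ 2 + mean_im nu x y ^+ 2.
Definition re_recip nu x y : R := mean_re nu x y / abs2_cauchy nu x y.
Definition im_recip nu x y : R := mean_im nu x y / abs2_cauchy nu x y.

Lemma cauchy_transformE nu x y : 0 < y ->
  cauchy_transform nu (x +i* y)%C = (mean_re nu x y +i* - mean_im nu x y)%C.
Proof.
move=> y0; rewrite /cauchy_transform /mean_re /mean_im.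
congr (_ +i* _)%C; first by apply: eq_Rintegral => t _ /=; rewrite subr0.
rewrite -mulN1r -meanZ; last exact: bounded_im_kernel.
by apply: eq_Rintegral => t _ /=; rewrite subr0 mulN1r.
Qed.

Lemma mean_im_gt0 nu x y : 0 < y -> 0 < mean_im nu x y.
Proof. by move=> y0; rewrite mean_imE// mulr_gt0// mean_poisson_gt0. Qed.

Lemma abs2_cauchy_gt0 nu x y : 0 < y -> 0 < abs2_cauchy nu x y.
Proof.
by move=> y0; rewrite /abs2_cauchy ltr_wpDl ?sqr_ge0// exprn_gt0// mean_im_gt0.
Qed.

Lemma recip_cauchyE nu x y : 0 < y ->
  recip_cauchy nu (x +i* y)%C = (re_recip nu x y +i* im_recip nu x y)%C.
Proof.
move=> y0; rewrite /recip_cauchy cauchy_transformE// /re_recip /im_recip /abs2_cauchy.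
rewrite /GRing.inv /=.
by rewrite sqrrN mulNr opprK.
Qed.

Lemma abs2_recip nu x y : 0 < y ->
  re_recip nu x y ^+ 2 + im_recip nu x y ^+ 2 = (abs2_cauchy nu x y)^-1.
Proof.
move=> y0; have := abs2_cauchy_gt0 nu x y0.
rewrite /re_recip /im_recip /abs2_cauchy => n0.
by field; rewrite gt_eqF.
Qed.

(** The diagonal value Im F(z) / Im z of the Pick kernel, in the form in which
    integrating [resolvent_ineq] produces it. *)
Lemma im_recip_mean nu x y : 0 < y ->
  im_recip nu x y = y * ((re_recip nu x y ^+ 2 + im_recip nu x y ^+ 2) * mean_poisson nu x y).
Proof.
by move=> y0; rewrite abs2_recip// /im_recip mean_imE//; ring.
Qed.

(** The variance of the random variable 1/(z - t), with t distributed according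
    to nu, is nonnegative. *)
Lemma abs2_cauchy_le nu x y : 0 < y -> abs2_cauchy nu x y <= mean_poisson nu x y.
Proof.
move=> y0.
set A := mean_re nu x y; set B := mean_im nu x y.
have bA := bounded_re_kernel x y0.
have bB := bounded_im_kernel x y0.
have bE := bounded_poisson_kernel x y0.
have : \int[nu]_t (2 * A * re_kernel x y t + 2 * B * im_kernel x y t - (A ^+ 2 + B ^+ 2)) <=
       mean_poisson nu x y.
  apply: mean_le => //.
    apply: bounded_measB; last exact: bounded_meas_cst.
    by apply: bounded_measD; exact: bounded_measZ.
  move=> t; have d0 := sqdist_gt0 x t y0.
  rewrite -subr_ge0 [X in 0 <= X](_ : _ = (A - re_kernel x y t) ^+ 2 + (B - im_kernel x y t) ^+ 2).
    by rewrite addr_ge0 ?sqr_ge0.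
  rewrite /poisson_kernel /re_kernel /im_kernel; move: d0; rewrite /sqdist => d0.
  by field; rewrite gt_eqF.
rewrite meanB ?mean_cst//; last exact: bounded_meas_cst.
  rewrite meanD; [|exact: bounded_measZ..].
  rewrite (meanZ nu _ bA) (meanZ nu _ bB).
  rewrite -/(mean_re nu x y) -/(mean_im nu x y) -/A -/B /abs2_cauchy -/A -/B; nra.
by apply: bounded_measD; exact: bounded_measZ.
Qed.

Lemma im_recip_ge nu x y : 0 < y -> y <= im_recip nu x y.
Proof.
move=> y0; have n0 := abs2_cauchy_gt0 nu x y0.
rewrite /im_recip ler_pdivlMr// mean_imE// ler_pM2l//.
exact: abs2_cauchy_le.
Qed.

Lemma im_recip_gt0 nu x y : 0 < y -> 0 < im_recip nu x y.
Proof. by move=> y0; exact: lt_le_trans (im_recip_ge nu x y0). Qed.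

(** With F = f + ig, F' = f' + ig', alpha = F/(z - t) and beta = F'/(z' - t), the
    left-hand side is the real part of (z - z') alpha beta, by the resolvent
    identity, and the claim is 2 |alpha beta| <= |alpha|^2 + |beta|^2. *)
Lemma resolvent_ineq (f g f' g' x y x' y' t : R) : 0 < y -> 0 < y' ->
  (re_kernel x' y' t - re_kernel x y t) * (f * f' - g * g') +
  (im_kernel x' y' t - im_kernel x y t) * (f * g' + g * f') <=
  (`|x - x'| + `|y - y'|) / 2 *
  ((f ^+ 2 + g ^+ 2) * poisson_kernel x y t +
   (f' ^+ 2 + g' ^+ 2) * poisson_kernel x' y' t).
Proof.
move=> y0 y0'; have d0 := sqdist_gt0 x t y0; have d0' := sqdist_gt0 x' t y0'.
pose u := x - t; pose u' := x' - t.
pose a1 := (f * u + g * y) / sqdist x y t; pose a2 := (g * u - f * y) / sqdist x y t.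
pose b1 := (f' * u' + g' * y') / sqdist x' y' t.
pose b2 := (g' * u' - f' * y') / sqdist x' y' t.
have -> : (f ^+ 2 + g ^+ 2) * poisson_kernel x y t = a1 ^+ 2 + a2 ^+ 2.
  rewrite /poisson_kernel /a1 /a2 /u; move: d0; rewrite /sqdist => d0.
  by field; rewrite gt_eqF.
have -> : (f' ^+ 2 + g' ^+ 2) * poisson_kernel x' y' t = b1 ^+ 2 + b2 ^+ 2.
  rewrite /poisson_kernel /b1 /b2 /u'; move: d0'; rewrite /sqdist => d0'.
  by field; rewrite gt_eqF.
rewrite [leLHS](_ : _ = (x - x') * (a1 * b1 - a2 * b2) - (y - y') * (a1 * b2 + a2 * b1)).
  have h1 (p q : R) : p * q <= `|p| * `|q| by rewrite -normrM ler_norm.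
  have q1 : `|a1 * b1 - a2 * b2| <= (a1 ^+ 2 + a2 ^+ 2 + (b1 ^+ 2 + b2 ^+ 2)) / 2.
    have := sqr_ge0 (a1 - b1); have := sqr_ge0 (a1 + b1).
    have := sqr_ge0 (a2 - b2); have := sqr_ge0 (a2 + b2).
    by rewrite ler_norml; nra.
  have q2 : `|a1 * b2 + a2 * b1| <= (a1 ^+ 2 + a2 ^+ 2 + (b1 ^+ 2 + b2 ^+ 2)) / 2.
    have := sqr_ge0 (a1 - b2); have := sqr_ge0 (a1 + b2).
    have := sqr_ge0 (a2 - b1); have := sqr_ge0 (a2 + b1).
    by rewrite ler_norml; nra.
  have := h1 (x - x') (a1 * b1 - a2 * b2).
  have := h1 (- (y - y')) (a1 * b2 + a2 * b1); rewrite normrN mulNr.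
  have := normr_ge0 (x - x'); have := normr_ge0 (y - y').
  move: q1 q2; nra.
rewrite /re_kernel /im_kernel /a1 /a2 /b1 /b2 /u /u'.
move: d0 d0'; rewrite /sqdist => d0 d0'.
by field; rewrite !gt_eqF.
Qed.

(** The Schwarz-Pick inequality, with the geometric mean of the two dilations
    replaced by their arithmetic mean: it is the integral of [resolvent_ineq]
    taken at the two values of the reciprocal transform. *)
Lemma re_recip_pick nu x y x' y' : 0 < y -> 0 < y' ->
  re_recip nu x y - re_recip nu x' y' <=
  (`|x - x'| + `|y - y'|) / 2 * (im_recip nu x y / y + im_recip nu x' y' / y').
Proof.
move=> y0 y0'.
pose f := re_recip nu x y; pose g := im_recip nu x y.
pose f' := re_recip nu x' y'; pose g' := im_recip nu x' y'.
have bA := bounded_re_kernel x y0; have bA' := bounded_re_kernel x' y0'.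
have bB := bounded_im_kernel x y0; have bB' := bounded_im_kernel x' y0'.
have bE := bounded_poisson_kernel x y0; have bE' := bounded_poisson_kernel x' y0'.
have bLA : bounded_meas (fun t => (f * f' - g * g') * (re_kernel x' y' t - re_kernel x y t)).
  exact/bounded_measZ/bounded_measB.
have bLB : bounded_meas (fun t => (f * g' + g * f') * (im_kernel x' y' t - im_kernel x y t)).
  exact/bounded_measZ/bounded_measB.
have bR1 : bounded_meas (fun t => (f ^+ 2 + g ^+ 2) * poisson_kernel x y t).
  exact/bounded_measZ.
have bR2 : bounded_meas (fun t => (f' ^+ 2 + g' ^+ 2) * poisson_kernel x' y' t).
  exact/bounded_measZ.
have := mean_le nu (bounded_measD bLA bLB)
  (bounded_measZ ((`|x - x'| + `|y - y'|) / 2) (bounded_measD bR1 bR2)).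
have H t : (f * f' - g * g') * (re_kernel x' y' t - re_kernel x y t) +
  (f * g' + g * f') * (im_kernel x' y' t - im_kernel x y t) <=
  (`|x - x'| + `|y - y'|) / 2 *
  ((f ^+ 2 + g ^+ 2) * poisson_kernel x y t +
   (f' ^+ 2 + g' ^+ 2) * poisson_kernel x' y' t).
  by have := resolvent_ineq f g f' g' x x' t y0 y0'; lra.
move=> /(_ H).
rewrite (meanD nu bLA bLB) (meanZ nu _ (bounded_measB bA' bA)).
rewrite (meanZ nu _ (bounded_measB bB' bB)) (meanB nu bA' bA) (meanB nu bB' bB).
rewrite (meanZ nu _ (bounded_measD bR1 bR2)) (meanD nu bR1 bR2).
rewrite (meanZ nu _ bE) (meanZ nu _ bE').
rewrite -!/(mean_re _ _ _) -!/(mean_im _ _ _) -!/(mean_poisson _ _ _).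
have e1 : im_recip nu x y / y = (f ^+ 2 + g ^+ 2) * mean_poisson nu x y.
  by rewrite im_recip_mean// mulrAC divff ?mul1r// gt_eqF.
have e2 : im_recip nu x' y' / y' = (f' ^+ 2 + g' ^+ 2) * mean_poisson nu x' y'.
  by rewrite im_recip_mean// mulrAC divff ?mul1r// gt_eqF.
rewrite e1 e2; apply: le_trans; rewrite le_eqVlt; apply/orP; left; apply/eqP.
have := abs2_cauchy_gt0 nu x y0; have := abs2_cauchy_gt0 nu x' y0'.
rewrite /f /f' /g /g' /re_recip /im_recip /abs2_cauchy => n0 n0'.
by field; rewrite !gt_eqF.
Qed.

Lemma re_recip_lipschitz nu (C : R) x y x' y' : 0 < y -> 0 < y' ->
  im_recip nu x y <= C * y -> im_recip nu x' y' <= C * y' ->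
  `|re_recip nu x y - re_recip nu x' y'| <= C * (`|x - x'| + `|y - y'|).
Proof.
move=> y0 y0' h h'.
have q : im_recip nu x y / y <= C by rewrite ler_pdivrMr.
have q' : im_recip nu x' y' / y' <= C by rewrite ler_pdivrMr.
have p1 := re_recip_pick nu x x' y0 y0'; have p2 := re_recip_pick nu x' x y0' y0.
rewrite (distrC x') (distrC y') in p2.
have := normr_ge0 (x - x'); have := normr_ge0 (y - y').
move: p1 p2; set s := `|_| + `|_| => p1 p2 s1 s2.
have s0 : 0 <= s by rewrite addr_ge0.
by rewrite ler_norml; apply/andP; split; nra.
Qed.

End reciprocal_cauchy.

(** * Behaviour at infinity *)

Section bounded_convergence.
Context {R : realType} {d : measure_display} {T : measurableType d}.

Lemma bounded_convergence (P : probability T R) (h_ : nat -> T -> R) (h : T -> R)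
    (M : R) :
  (forall n, measurable_fun setT (h_ n)) -> measurable_fun setT h ->
  (forall n t, `|h_ n t| <= M) ->
  {ae P, forall t, h_ n t @[n --> \oo] --> h t} ->
  \int[P]_t h_ n t @[n --> \oo] --> \int[P]_t h t.
Proof.
move=> mh_ mh hM hcvg.
have iM : P.-integrable setT (cst M%:E) by apply: finite_measure_integrable_cst.
have [] := @dominated_convergence _ _ _ P setT measurableT
  (fun n t => (h_ n t)%:E) (fun t => (h t)%:E) (cst M%:E).
- by move=> n; exact/measurable_EFinP.
- exact/measurable_EFinP.
- apply: filterS hcvg => t ht _; by apply: cvg_EFin; [exact: nearW | exact: ht].
- exact: iM.
- apply: aeW => t n _; rewrite /= lee_fin; exact: hM.
move=> ih _ cv; apply: fine_cvg.
rewrite fineK; first exact: cv.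
exact: integrable_fin_num.
Qed.

Lemma ae_imply2 (P : probability T R) (A B D : T -> Prop) :
  (forall t, A t -> B t -> D t) ->
  {ae P, forall t, A t} -> {ae P, forall t, B t} -> {ae P, forall t, D t}.
Proof. by move=> ABD; exact: filterS2. Qed.

End bounded_convergence.

Section nontangential.
Context {R : realType}.
Implicit Types (nu : borel_prob R).

(** Seen from far away, nu is a point mass at 0. *)
Lemma mean_dilation_cvg nu (h : R -> R) : continuous h -> bounded_meas h ->
  \int[nu]_t h (t / n.+1%:R) @[n --> \oo] --> h 0.
Proof.
move=> ch [mh [M hM]]; rewrite -(mean_cst nu (h 0)).
apply: (@bounded_convergence _ _ _ _ _ _ M) => //.
  move=> n; apply: measurableT_comp => //.
  by apply: measurable_funM => //; exact: measurable_cst.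
apply: aeW => t.
apply: (@cvg_comp _ _ _ (fun n : nat => t / n.+1%:R) h _ (nbhs (0:R))); last exact: ch.
have := cvgM (cvg_cst t) (@cvg_harmonic R); rewrite mulr0; exact.
Qed.

Lemma sqdist_scale (m x y t : R) : sqdist (m * x) (m * y) (m * t) = m ^+ 2 * sqdist x y t.
Proof. by rewrite /sqdist; ring. Qed.

Lemma re_kernel_scale (m x y t : R) : 0 < m -> 0 < y ->
  m * re_kernel (m * x) (m * y) (m * t) = re_kernel x y t.
Proof.
move=> m0 y0; rewrite /re_kernel sqdist_scale; have := sqdist_gt0 x t y0.
by move: (sqdist x y t) => D D0; field; rewrite !gt_eqF.
Qed.

Lemma im_kernel_scale (m x y t : R) : 0 < m -> 0 < y ->
  m * im_kernel (m * x) (m * y) (m * t) = im_kernel x y t.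
Proof.
move=> m0 y0; rewrite /im_kernel sqdist_scale; have := sqdist_gt0 x t y0.
by move: (sqdist x y t) => D D0; field; rewrite !gt_eqF.
Qed.

(** F(z) is asymptotic to z along every ray of the upper half-plane.  After
    rescaling by n this is dominated convergence. *)
Lemma recip_nontangential nu (e : R) : 0 < e ->
  re_recip nu (- n.+1%:R) (e * n.+1%:R) / n.+1%:R @[n --> \oo] --> (-1 : R).
Proof.
move=> e0; pose r n : R := n.+1%:R.
have n0 n : 0 < r n by rewrite /r.
have en n : 0 < e * r n by rewrite mulr_gt0.
have tE n (t : R) : t = r n * (t / r n) by rewrite mulrC divfK// gt_eqF.
have rE n : - r n = r n * -1 by rewrite mulrN1.
have hA : r n * mean_re nu (- r n) (e * r n) @[n --> \oo] --> re_kernel (-1) e 0.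
  have -> : (fun n => r n * mean_re nu (- r n) (e * r n)) =
      (fun n => \int[nu]_t re_kernel (-1) e (t / r n)).
    apply/funext => n; rewrite -(meanZ nu _ (bounded_re_kernel (- r n) (en n))).
    apply: eq_Rintegral => t _.
    by rewrite [in LHS](tE n t) rE (mulrC e) re_kernel_scale.
  by apply: mean_dilation_cvg; [exact: continuous_re_kernel|exact: bounded_re_kernel].
have hB : r n * mean_im nu (- r n) (e * r n) @[n --> \oo] --> im_kernel (-1) e 0.
  have -> : (fun n => r n * mean_im nu (- r n) (e * r n)) =
      (fun n => \int[nu]_t im_kernel (-1) e (t / r n)).
    apply/funext => n; rewrite -(meanZ nu _ (bounded_im_kernel (- r n) (en n))).
    apply: eq_Rintegral => t _.
    by rewrite [in LHS](tE n t) rE (mulrC e) im_kernel_scale.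
  by apply: mean_dilation_cvg; [exact: continuous_im_kernel|exact: bounded_im_kernel].
have lE : re_kernel (-1) e 0 ^+ 2 + im_kernel (-1) e 0 ^+ 2 = (1 + e ^+ 2)^-1.
  rewrite /re_kernel /im_kernel /sqdist; field.
  by rewrite gt_eqF//; have := sqr_ge0 e; lra.
have l0 : re_kernel (-1) e 0 * re_kernel (-1) e 0 +
          im_kernel (-1) e 0 * im_kernel (-1) e 0 != 0.
  by rewrite -!expr2 lE invr_eq0 gt_eqF//; have := sqr_ge0 e; lra.
pose a n := r n * mean_re nu (- r n) (e * r n).
pose b n := r n * mean_im nu (- r n) (e * r n).
have H : a n * (a n * a n + b n * b n)^-1 @[n --> \oo] --> (-1 : R).
  have -> : -1 = re_kernel (-1) e 0 * (re_kernel (-1) e 0 * re_kernel (-1) e 0 +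
          im_kernel (-1) e 0 * im_kernel (-1) e 0)^-1.
    rewrite -!expr2 lE invrK.
    by rewrite /re_kernel /sqdist; field; rewrite gt_eqF//; have := sqr_ge0 e; lra.
  apply: cvgM => //; apply: cvgV => //.
  by apply: cvgD; apply: cvgM.
apply: cvg_trans H; apply: near_eq_cvg; apply: nearW => n /=; rewrite /a /b.
have := abs2_cauchy_gt0 nu (- r n) (en n).
rewrite /re_recip /abs2_cauchy -/(r n) => D0.
move: D0 (n0 n); move: (mean_re _ _ _) => A; move: (mean_im _ _ _) => B.
move: (r n) => s D0 s0.
field; rewrite !gt_eqF//= [ltRHS](_ : _ = s ^+ 2 * (A ^+ 2 + B ^+ 2)); last by ring.
by rewrite mulr_gt0// exprn_gt0.
Qed.

(** Nontangential asymptotics controls the transform on the ray of slope [e];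
    the Lipschitz bound carries this control down to the real axis. *)
Lemma re_recip_left nu (C x2 M : R) : 0 < C ->
  (forall x y : R, x <= x2 -> 0 < y -> im_recip nu x y <= C * y) ->
  exists x0 y0, [/\ x0 <= x2, 0 < y0 &
    forall y : R, 0 < y -> y <= y0 -> re_recip nu x0 y < M].
Proof.
move=> C0 hC; pose e := (4 * C)^-1.
have e0 : 0 < e by rewrite invr_gt0 mulr_gt0.
have [n [h1 h2]] : exists n : nat,
    re_recip nu (- n.+1%:R) (e * n.+1%:R) / n.+1%:R < - (3 / 4) /\
    `|x2| + 2 * `|M| < n.+1%:R.
  have H1 : \forall n \near \oo, re_recip nu (- n.+1%:R) (e * n.+1%:R) / n.+1%:R < - (3 / 4).
    by apply: cvgr_lt (recip_nontangential nu e0) _ _; lra.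
  have H2 : \forall n \near \oo, `|x2| + 2 * `|M| < n.+1%:R :> R.
    near=> n; apply: (@lt_trans _ _ n%:R); last by rewrite ltr_nat.
    by near: n; exact: nbhs_infty_gtr.
  by have [n _ Hn] := filterI H1 H2; exists n; exact: (Hn n (leqnn n)).
set r : R := n.+1%:R in h1 h2.
have r0 : 0 < r by rewrite /r.
have er : 0 < e * r by rewrite mulr_gt0.
have rx : - r <= x2.
  by have := ler_norm (- x2); rewrite normrN; have := normr_ge0 M; lra.
exists (- r), (e * r); split=> // y y0 ye.
have := re_recip_lipschitz y0 er (hC _ _ rx y0) (hC _ _ rx er).
rewrite subrr normr0 add0r.
rewrite ler_distl => /andP[_].
rewrite distrC ger0_norm ?subr_ge0//.
rewrite ltr_pdivrMr// in h1.
have Ce : C * (e * r) = r / 4 by rewrite /e; field; rewrite gt_eqF.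
have := ler_norm (- M); rewrite normrN; have := normr_ge0 x2.
have : 0 < C * y by rewrite mulr_gt0.
rewrite mulrBr Ce; lra.
Unshelve. all: by end_near. Qed.

End nontangential.

(** * A measure with one atom below a ray *)

Section measurable_inverse.
Context {R : realType}.

(** A pointwise limit of the continuous kernels [re_kernel x y] as y tends to 0;
    at t = x both sides vanish, by the convention 1/0 = 0. *)
Lemma measurable_inv_sub (x : R) : measurable_fun [set: R] (fun t => (x - t)^-1).
Proof.
apply: (@measurable_fun_cvg _ _ _ _ (fun n => re_kernel x n.+1%:R^-1)).
  by move=> n; have [] := @bounded_re_kernel R x n.+1%:R^-1; rewrite ?invr_gt0.
move=> t _; rewrite /re_kernel /sqdist.
have [->|xt] := eqVneq x t.
  by rewrite subrr invr0; under eq_fun do rewrite mul0r; exact: cvg_cst.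
have xt0 : x - t != 0 by rewrite subr_eq0.
rewrite [X in _ --> X](_ : _ = (x - t) * ((x - t) ^+ 2 + 0 * 0)^-1); last first.
  by field; rewrite xt0.
apply: cvgM; first exact: cvg_cst.
apply: cvgV; first by rewrite mul0r addr0 expf_neq0.
apply: cvgD; first exact: cvg_cst.
by under eq_fun do rewrite expr2; apply: cvgM; exact: cvg_harmonic.
Qed.

End measurable_inverse.

Section atom_and_ray.
Context {R : realType} (mu : borel_prob R) (a b : R).
Hypothesis hab : a < b.
Hypothesis ha : (0 < mu [set a])%E.
Hypothesis hsum : (mu [set a] + mu `[b, +oo[%classic = 1)%E.
Hypothesis hlim : real_cauchy_transform mu x @[x --> b^'-] --> (0 : R).

Let S : set (measurableTypeR R) := [set a] `|` `[b, +oo[%classic.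
Let p : R := fine (mu [set a]).

Let measurable_S : measurable S.
Proof. exact: measurableU. Qed.

Let mu_S : mu S = 1%E.
Proof.
rewrite -hsum measureU//.
by rewrite -subset0 => t [/= ->]; rewrite in_itv/= andbT leNgt hab.
Qed.

Let mu_a : mu [set a] = p%:E.
Proof. by rewrite fineK// fin_num_measure. Qed.

Let p_gt0 : 0 < p.
Proof. by rewrite -lte_fin -mu_a. Qed.

Let bounded_atom : bounded_meas (\1_[set a] : R -> R).
Proof.
split; first exact: measurable_indic.
by exists 1 => t; rewrite indicE; case: (_ \in _); rewrite ?normr0 ?normr1.
Qed.

Let mean_atom : \int[mu]_t (\1_[set a] t) = p.
Proof. by rewrite /Rintegral integral_indic// setIT. Qed.

Let atomE (t : R) : (\1_[set a] : R -> R) t = (t == a)%:R.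
Proof. by rewrite indicE; congr (nat_of_bool _)%:R; apply/idP/eqP; rewrite inE. Qed.

(* The cut-off outside the support makes the integrand of the real Cauchy transform
   bounded and does not change the integral. *)
Let inv_kernel (x t : R) : R := (x - t)^-1 * \1_S t.

Let inv_kernelE x t : S t -> inv_kernel x t = (x - t)^-1.
Proof. by move=> St; rewrite /inv_kernel indicE mem_set// mulr1. Qed.

Let bounded_inv_kernel x : a < x -> x < b -> bounded_meas (inv_kernel x).
Proof.
move=> ax xb; split.
  by apply: measurable_funM; [exact: measurable_inv_sub|exact: measurable_indic].
exists ((x - a)^-1 + (b - x)^-1) => t.
have p1 : 0 < (x - a)^-1 by rewrite invr_gt0 subr_gt0.
have p2 : 0 < (b - x)^-1 by rewrite invr_gt0 subr_gt0.
rewrite /inv_kernel indicE; case: (boolP (t \in S)) => [|_]; last first.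
  by rewrite mulr0 normr0; lra.
rewrite inE mulr1 => -[/= ->|/=]; first by rewrite gtr0_norm//; lra.
rewrite in_itv/= andbT => bt; rewrite normfV distrC gtr0_norm; last by lra.
apply: (@le_trans _ _ (b - x)^-1); last by lra.
by rewrite lef_pV2 ?posrE; lra.
Qed.

Let G x := real_cauchy_transform mu x.

Let GE x : G x = \int[mu]_t inv_kernel x t.
Proof.
rewrite /G /real_cauchy_transform /Rintegral; congr fine.
apply: ae_eq_integral => //.
- by apply/measurable_EFinP; exact: measurable_inv_sub.
- apply/measurable_EFinP; apply: measurable_funM; first exact: measurable_inv_sub.
  exact: measurable_indic.
- exists (~` S); split; first exact: measurableC.
    by have := probability_setC mu measurable_S; rewrite mu_S subee.
  by move=> t /= h St; apply: h => _; rewrite inv_kernelE.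
Qed.

Let supp (P : R -> Prop) : P a -> (forall t, b <= t -> P t) -> forall t, S t -> P t.
Proof.
by move=> Pa Pb t [/= ->//|/=]; rewrite in_itv/= andbT => bt; exact: Pb.
Qed.

(* Between the atom and the ray, the transform decreases to 0 at b, and so does
   what is left of it when the contribution of the atom is subtracted. *)
Let G_sub_atom_noninc x x' : a < x -> x <= x' -> x' < b ->
  G x' - p / (x' - a) <= G x - p / (x - a).
Proof.
move=> ax xx' x'b.
have ax' : a < x' by lra. have xb : x < b by lra.
have E z : a < z -> z < b ->
    G z - p / (z - a) = \int[mu]_t (inv_kernel z t - (z - a)^-1 * \1_[set a] t).
  move=> az zb; rewrite (meanB mu (bounded_inv_kernel az zb)); last exact: bounded_measZ.
  by rewrite (meanZ mu _ bounded_atom) mean_atom -GE mulrC.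
have Bd z : a < z -> z < b ->
    bounded_meas (fun t => inv_kernel z t - (z - a)^-1 * \1_[set a] t).
  by move=> az zb; apply: bounded_measB; [exact: bounded_inv_kernel|exact: bounded_measZ].
rewrite !E//; apply: (mean_le_ae measurable_S mu_S); [exact: Bd..|].
move=> t St; rewrite !inv_kernelE// !atomE; move: t St.
apply: supp => [|t bt]; first by rewrite eqxx !mulr1 !subrr.
rewrite gt_eqF ?mulr0 ?subr0; last by lra.
rewrite -lerN2 -!invrN !opprB.
by rewrite lef_pV2 ?posrE; lra.
Qed.

(** Passing to the limit at b in the monotonicity of what is left of G without
    the atom turns the hypothesis that G vanishes at b into a lower bound on the
    whole interval. *)
Lemma real_cauchy_transform_ge x : a < x -> x < b ->
  p / (x - a) - p / (b - a) <= G x.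
Proof.
move=> ax xb.
suff: - (p / (b - a)) <= G x - p / (x - a) by lra.
have ba0 : b - a != 0 by rewrite subr_eq0 gt_eqF.
have H : G x' - p / (x' - a) @[x' --> b^'-] --> 0 - p / (b - a).
  apply: cvgB; first exact: hlim.
  apply: cvgM; first exact: cvg_cst.
  apply: cvgV => //; apply: cvgB; last exact: cvg_cst.
  exact: cvg_at_left_filter.
rewrite sub0r in H.
rewrite leNgt; apply/negP => lt.
have : \forall x' \near b^'-, G x - p / (x - a) < G x' - p / (x' - a).
  exact: cvgr_gt H _ lt.
move=> /(filterI (nbhs_left_gt xb)) /(filterI (nbhs_left_lt b)) /filter_ex.
move=> [x' [x'b [xx' /lt_geF]]].
by rewrite G_sub_atom_noninc// ltW.
Qed.

Lemma real_cauchy_transform_gt0 x : a < x -> x < b -> 0 < G x.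
Proof.
move=> ax xb; apply: lt_le_trans (real_cauchy_transform_ge ax xb).
by rewrite subr_gt0 ltr_pM2l// ltf_pV2 ?posrE; lra.
Qed.

Let numerator x y t : R := (x - a) * re_kernel x y t + y * im_kernel x y t.

Let bounded_numerator x y : 0 < y -> bounded_meas (numerator x y).
Proof.
move=> y0; apply: bounded_measD; apply: bounded_measZ.
  exact: bounded_re_kernel.
exact: bounded_im_kernel.
Qed.

Let mean_numerator x y : 0 < y ->
  \int[mu]_t numerator x y t = (x - a) * mean_re mu x y + y * mean_im mu x y.
Proof.
move=> y0; have bA := bounded_re_kernel x y0; have bB := bounded_im_kernel x y0.
rewrite (meanD mu (bounded_measZ (x - a) bA) (bounded_measZ y bB)).
by rewrite (meanZ mu _ bA) (meanZ mu _ bB).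
Qed.

Let numerator_atom x y : 0 < y -> numerator x y a = 1.
Proof.
move=> y0; have := sqdist_gt0 x a y0; rewrite /numerator /re_kernel /im_kernel /sqdist.
by move=> D0; field; rewrite gt_eqF.
Qed.

(* The right-hand side is the real part of (z - a) G(z).  Kernel by kernel it is
   at least its value (x - a) G(x) on the real line, for x > a, and at least the
   contribution p of the atom, for x <= a; so it has no zero down to the real
   line, not even at the atom. *)
Let numerator_ge x x2 y : a < x2 -> x2 < b -> x <= x2 -> 0 < y ->
  p * (b - x2) / (b - a) <= (x - a) * mean_re mu x y + y * mean_im mu x y.
Proof.
move=> ax2 x2b xx2 y0; rewrite -mean_numerator//.
have ba0 : 0 < b - a by rewrite subr_gt0.
have [xa|ax] := leP x a.
  apply: (@le_trans _ _ p).
    rewrite ler_pdivrMr// ler_pM2l//; lra.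
  rewrite -mean_atom; apply: (mean_le_ae measurable_S mu_S) => //.
    exact: bounded_numerator.
  apply: supp => [|t bt]; first by rewrite atomE eqxx numerator_atom.
  rewrite atomE gt_eqF /=; last by lra.
  rewrite /numerator /re_kernel /im_kernel !mulrA -mulrDl.
  rewrite divr_ge0 ?(ltW (sqdist_gt0 _ _ _))//.
  by apply: addr_ge0; [apply: mulr_le0; lra|apply: mulr_ge0; exact: ltW].
have xb : x < b by lra.
apply: (@le_trans _ _ ((x - a) * G x)).
  apply: (@le_trans _ _ ((x - a) * (p / (x - a) - p / (b - a)))); last first.
    by rewrite ler_pM2l ?subr_gt0// real_cauchy_transform_ge.
  have xa0 : x - a != 0 by rewrite subr_eq0 gt_eqF.
  rewrite [leRHS](_ : _ = p * (b - x) / (b - a)); last first.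
    by field; rewrite xa0 gt_eqF.
  by rewrite ler_pM2r ?invr_gt0// ler_pM2l//; lra.
rewrite GE -(meanZ mu _ (bounded_inv_kernel ax xb)).
apply: (mean_le_ae measurable_S mu_S).
- exact/bounded_measZ/bounded_inv_kernel.
- exact: bounded_numerator.
move=> t St; rewrite inv_kernelE//; move: t St.
have xa0 : x - a != 0 by rewrite subr_eq0 gt_eqF.
apply: supp => [|t bt]; first by rewrite divff// numerator_atom.
have tx0 : x - t != 0 by rewrite subr_eq0 lt_eqF//; lra.
have D0 := sqdist_gt0 x t y0.
rewrite -subr_ge0 [X in 0 <= X](_ : _ = y ^+ 2 * (t - a) / (t - x) / sqdist x y t).
  by rewrite !divr_ge0 ?mulr_ge0 ?sqr_ge0 ?(ltW D0)//; lra.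
rewrite /numerator /re_kernel /im_kernel; move: D0; rewrite /sqdist => D0.
field; rewrite tx0 (gt_eqF D0) ?andbT/= subr_eq0 gt_eqF//; lra.
Qed.

Let mean_poisson_le x x2 y : a < x2 -> x2 < b -> x <= x2 -> 0 < y ->
  mean_poisson mu x y * sqdist x y a <= 1 + ((x2 - a) / (b - x2)) ^+ 2.
Proof.
move=> ax2 x2b xx2 y0; set k := (x2 - a) / (b - x2).
have k0 : 0 <= k by rewrite divr_ge0; lra.
have bE := bounded_poisson_kernel x y0.
rewrite mulrC -(meanZ mu _ bE) -[leRHS](mean_cst mu).
apply: (mean_le_ae measurable_S mu_S); [exact: bounded_measZ|exact: bounded_meas_cst|].
apply: supp => [|t bt].
  by rewrite /poisson_kernel divff ?gt_eqF ?sqdist_gt0// lerDl sqr_ge0.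
rewrite /poisson_kernel ler_pdivrMr ?sqdist_gt0//.
rewrite /sqdist mulrDl mul1r mulrDr.
have h : (x - a) ^+ 2 <= (1 + k ^+ 2) * (x - t) ^+ 2.
  have [xa|ax] := leP x a.
    have : 0 <= k ^+ 2 * (x - t) ^+ 2 by rewrite mulr_ge0 ?sqr_ge0.
    have : (x - a) ^+ 2 <= (x - t) ^+ 2 by nra.
    lra.
  have : 0 <= (x - t) ^+ 2 by rewrite sqr_ge0.
  suff : (x - a) ^+ 2 <= (k * (x - t)) ^+ 2 by rewrite exprMn; lra.
  rewrite -[leRHS]sqrrN ler_pXn2r// ?nnegrE; [|lra|].
    rewrite -mulrN opprB /k mulrAC ler_pdivlMr; last by lra.
    by rewrite ler_pM; lra.
  by rewrite -mulrN mulr_ge0//; lra.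
have : 0 <= k ^+ 2 * y ^+ 2 by rewrite mulr_ge0 ?sqr_ge0.
lra.
Qed.

(** This is what makes F continuable across the half-line below b.  As Im F is
    Im z times a Poisson integral over |G|^2, it suffices to multiply both by
    |z - a|^2: the Poisson integral becomes bounded and |G|^2 becomes bounded
    away from 0, also at the atom. *)
Lemma im_recip_le x2 : a < x2 -> x2 < b -> exists2 C : R, 0 < C &
  forall x y : R, x <= x2 -> 0 < y -> im_recip mu x y <= C * y.
Proof.
move=> ax2 x2b; pose m := p * (b - x2) / (b - a).
have m0 : 0 < m by rewrite divr_gt0 ?mulr_gt0// subr_gt0.
pose K := 1 + ((x2 - a) / (b - x2)) ^+ 2.
have K0 : 0 < K by rewrite /K ltr_pwDl// sqr_ge0.
exists (K / m ^+ 2); first by rewrite divr_gt0// exprn_gt0.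
move=> x y xx2 y0.
have D0 := sqdist_gt0 x a y0.
have N0 := abs2_cauchy_gt0 mu x y0.
have hK := mean_poisson_le ax2 x2b xx2 y0.
have hm := numerator_ge ax2 x2b xx2 y0.
have hmm : m ^+ 2 <= sqdist x y a * abs2_cauchy mu x y.
  apply: (@le_trans _ _ (((x - a) * mean_re mu x y + y * mean_im mu x y) ^+ 2)).
    by rewrite ler_pXn2r ?nnegrE ?(ltW m0)//; exact: le_trans (ltW m0) hm.
  rewrite /sqdist /abs2_cauchy.
  have := sqr_ge0 ((x - a) * mean_im mu x y - y * mean_re mu x y); nra.
rewrite /im_recip mean_imE// ler_pdivrMr// [leLHS]mulrC.
rewrite [leRHS](_ : _ = (K * abs2_cauchy mu x y / m ^+ 2) * y); last by ring.
rewrite ler_pM2r// ler_pdivlMr ?exprn_gt0//.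
have E0 := mean_poisson_gt0 mu x y0.
apply: (@le_trans _ _ (mean_poisson mu x y * (sqdist x y a * abs2_cauchy mu x y))).
  by rewrite ler_pM2l.
by rewrite mulrA ler_pM2r.
Qed.

Lemma mean_poisson_le_dist x y (d : R) : 0 < d -> d <= `|x - a| -> x + d <= b ->
  0 < y -> mean_poisson mu x y <= (d ^+ 2)^-1.
Proof.
move=> d0 dxa xdb y0; rewrite -(mean_cst mu (d ^+ 2)^-1).
apply: (mean_le_ae measurable_S mu_S).
- exact: bounded_poisson_kernel.
- exact: bounded_meas_cst.
move=> t St; rewrite /poisson_kernel lef_pV2 ?posrE ?sqdist_gt0 ?exprn_gt0//.
rewrite /sqdist -[leLHS]addr0 lerD ?sqr_ge0//.
rewrite -(real_normK (num_real (x - t))) ler_pXn2r ?nnegrE ?normr_ge0 ?(ltW d0)//.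
move: t St; apply: supp => // t bt; rewrite distrC ger0_norm; lra.
Qed.

(** F(x) = 1/G(x) tends to plus infinity at b because G is positive and tends to
    0 there; near x the transform is close to its value on the real line. *)
Lemma re_recip_near_ray (M : R) : exists x y0 : R, [/\ a < x, x < b, 0 < y0 &
  forall y, 0 < y -> y <= y0 -> M < re_recip mu x y].
Proof.
pose e : R := (4 * (1 + `|M|))^-1.
have e0 : 0 < e by rewrite invr_gt0 mulr_gt0// ltr_pwDl.
have : \forall x \near b^'-, G x < e by exact: cvgr_lt hlim _ e0.
move=> /(filterI (nbhs_left_gt hab)) /(filterI (nbhs_left_lt b)) /filter_ex.
move=> [x [xb [ax Ge]]]; exists x.
have G0 := real_cauchy_transform_gt0 ax xb.
pose d := Num.min (x - a) (b - x).
have d0 : 0 < d by rewrite lt_min !subr_gt0 ax.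
have dS : forall t, S t -> d <= `|x - t|.
  apply: supp => [|t bt]; first by rewrite ge_min ler_norm.
  rewrite ge_min distrC; apply/orP; right; apply: le_trans (ler_norm _); lra.
exists (d ^+ 2 * G x / 4); split=> //.
  by rewrite divr_gt0// mulr_gt0// exprn_gt0.
move=> y y0 yd.
have yG : y / d ^+ 2 <= G x / 4.
  by rewrite ler_pdivrMr ?exprn_gt0// mulrC mulrA.
have bA := bounded_re_kernel x y0; have bG := bounded_inv_kernel ax xb.
have dif t : S t -> `|re_kernel x y t - inv_kernel x t| <= y / d ^+ 2.
  move=> St; rewrite inv_kernelE//; have := dS _ St.
  set u := x - t => du; have u0 : u != 0 by rewrite -normr_gt0 (lt_le_trans d0).
  have D0 : 0 < u ^+ 2 + y ^+ 2 by exact: sqdist_gt0.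
  have au0 : 0 < `|u| by rewrite normr_gt0.
  rewrite /re_kernel /sqdist -/u.
  rewrite (_ : _ - _ = - (y ^+ 2 / (u * (u ^+ 2 + y ^+ 2)))); last first.
    by field; rewrite u0 gt_eqF.
  rewrite normrN normrM normfV [X in _ / X]normrM (gtr0_norm D0) ger0_norm ?sqr_ge0//.
  rewrite ler_pdivrMr ?mulr_gt0// mulrAC ler_pdivlMr ?exprn_gt0//.
  rewrite -(real_normK (num_real u)); move: du au0; set v := `|u| => dv v0.
  have : y * d ^+ 2 <= v * (v ^+ 2 + y ^+ 2).
    have : d ^+ 2 <= v ^+ 2 by rewrite ler_pXn2r ?nnegrE ?(ltW d0) ?(ltW v0).
    have := sqr_ge0 (v - y); nra.
  by nra.
have hA : `|mean_re mu x y - G x| <= G x / 4.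
  apply: le_trans yG; rewrite GE -(meanB mu bA bG).
  have bD := bounded_measB bA bG.
  rewrite ler_norml -[leLHS](mean_cst mu) -[X in _ && (_ <= X)](mean_cst mu).
  apply/andP; split; apply: (mean_le_ae measurable_S mu_S) => //;
    try exact: bounded_meas_cst.
    by move=> t /dif; rewrite ler_norml => /andP[].
  by move=> t /dif; rewrite ler_norml => /andP[].
have hB : mean_im mu x y <= G x / 4.
  apply: le_trans yG; rewrite mean_imE// ler_pM2l//.
  apply: mean_poisson_le_dist => //.
    by rewrite ge_min ler_norm.
  by rewrite -lerBrDl ge_min lexx orbT.
have B0 := mean_im_gt0 mu x y0.
have N0 := abs2_cauchy_gt0 mu x y0.
have MG : (1 + `|M|) * (4 * G x) < 1.
  have h : 0 < 4 * (1 + `|M|) by rewrite mulr_gt0// ltr_pwDl.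
  by have := Ge; rewrite -(ltr_pM2l h) /e mulfV ?gt_eqF//; lra.
have := ler_norm M.
move: hA; rewrite ler_distl => /andP[A1 A2] nM.
rewrite /re_recip ltr_pdivlMr//.
apply: (@le_lt_trans _ _ ((1 + `|M|) * abs2_cauchy mu x y)).
  by rewrite ler_pM2r//; lra.
have Nle : abs2_cauchy mu x y <= 2 * (G x) ^+ 2.
  by rewrite /abs2_cauchy; nra.
apply: (@le_lt_trans _ _ ((1 + `|M|) * (4 * G x) * (G x / 2))).
  have : 0 < 1 + `|M| by rewrite ltr_pwDl.
  nra.
apply: (@lt_trans _ _ (1 * (G x / 2))); last by lra.
by rewrite ltr_pM2r// divr_gt0.
Qed.


End atom_and_ray.

(** * Measures concentrated at a point *)

Section dirac_criteria.
Context {R : realType}.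
Implicit Types (nu : borel_prob R).

(** On the interval the Poisson kernel is at least 1/(2 v^2). *)
Lemma ball_le_mean_poisson nu (w y v : R) : 0 < y -> y <= v ->
  fine (nu `[w - y, w + y]%classic) <= 2 * v ^+ 2 * mean_poisson nu w v.
Proof.
move=> y0 yv; have v0 := lt_le_trans y0 yv.
have bE := bounded_poisson_kernel w v0.
rewrite -(meanZ nu _ bE).
have mI : measurable (`[w - y, w + y]%classic : set (measurableTypeR R)) by [].
have -> : fine (nu `[w - y, w + y]%classic) = \int[nu]_t (\1_(`[w - y, w + y]%classic) t).
  by rewrite /Rintegral integral_indic// setIT.
apply: mean_le.
- split; first exact: measurable_indic.
  by exists 1 => t; rewrite indicE; case: (_ \in _); rewrite ?normr0 ?normr1.
- exact: bounded_measZ.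
move=> t; have D0 := sqdist_gt0 w t v0; rewrite /poisson_kernel indicE.
case: (boolP (t \in _)) => [|_]; last first.
  by rewrite divr_ge0 ?(ltW D0)// mulr_ge0// sqr_ge0.
rewrite inE/= in_itv/= => /andP[t1 t2].
by rewrite ler_pdivlMr// mul1r /sqdist; nra.
Qed.


(** A bounded Poisson integral gives mass O(y^2) to an interval of length 2y;
    cutting [w1, w2] into n pieces leaves total mass O(1/n).  The height v at which
    the bound is known may depend on the point, within a constant factor of y. *)
Lemma null_interval nu (w1 w2 y0 C K : R) : w1 < w2 -> 0 < y0 -> 0 < C -> 0 <= K ->
  (forall w y : R, w1 <= w -> w <= w2 -> 0 < y -> y <= y0 ->
    exists v, [/\ y <= v, v <= C * y & mean_poisson nu w v <= K]) ->
  nu `[w1, w2]%classic = 0%E.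
Proof.
move=> w12 y00 C0 K0 H.
have step (y : R) (n : nat) : 0 < y -> y <= y0 -> w1 + n%:R * (2 * y) <= w2 ->
    (0 < n)%N ->
    fine (nu `[w1, w1 + n%:R * (2 * y)]%classic) <= n%:R * (2 * C ^+ 2 * y ^+ 2 * K).
  move=> y0' yy0; set B := 2 * _ * _ * _.
  have ball (w : R) : w1 <= w -> w <= w2 -> fine (nu `[w - y, w + y]%classic) <= B.
    move=> h1 h2; have [v [yv vC mK]] := H w y h1 h2 y0' yy0.
    apply: le_trans (ball_le_mean_poisson _ _ y0' yv) _.
    have v0 := lt_le_trans y0' yv.
    have v2 : v ^+ 2 <= (C * y) ^+ 2 by rewrite ler_pXn2r ?nnegrE ?(ltW v0)// mulr_ge0// ltW.
    rewrite /B; apply: (@le_trans _ _ (2 * v ^+ 2 * K)).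
      by rewrite ler_wpM2l// mulr_ge0// sqr_ge0.
    by rewrite ler_wpM2r// -mulrA -exprMn ler_pM2l.
  elim: n => // n IH wn _.
  have ny : n.+1%:R * (2 * y) = n%:R * (2 * y) + 2 * y by rewrite -natr1; ring.
  have n0 : 0 <= n%:R * (2 * y) by rewrite mulr_ge0// mulr_ge0// ltW.
  rewrite ny in wn *.
  pose w := w1 + n%:R * (2 * y) + y.
  have bw : fine (nu `[w - y, w + y]%classic) <= B by apply: ball; rewrite /w; lra.
  have [n00|np] := posnP n.
    rewrite n00 mul0r add0r mul1r.
    apply: le_trans bw; rewrite /w n00 !mul0r addr0 addrK -addrA.
    by rewrite (_ : y + y = 2 * y)//; ring.
  have -> : n.+1%:R * B = n%:R * B + B by rewrite -natr1; ring.
  apply: le_trans (lerD (IH _ np) bw); last by lra.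
  rewrite -fineD ?fin_num_measure//; try exact: measurable_itv.
  apply: fine_le; rewrite ?fin_numD ?fin_num_measure//.
  apply: le_trans; last by apply: measureU2.
  apply: le_measure; rewrite ?inE//; first exact: measurableU.
  move=> t /=; rewrite !in_itv/= => /andP[t1 t2].
  have [tl|tl] := leP t (w1 + n%:R * (2 * y)); first by left; rewrite t1.
  by right; rewrite /w; apply/andP; split; lra.
have Q0 : 0 <= C ^+ 2 * K * (w2 - w1) ^+ 2.
  by apply: mulr_ge0; [apply: mulr_ge0 => //|]; exact: sqr_ge0.
have le_n (n : nat) : (0 < n)%N -> (w2 - w1) / (2 * y0) <= n%:R ->
    fine (nu `[w1, w2]%classic) <= (C ^+ 2 * K * (w2 - w1) ^+ 2) / n%:R.
  move=> n0 nl; have nr : (0 : R) < n%:R by rewrite ltr0n.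
  pose y := (w2 - w1) / (2 * n%:R).
  have y0' : 0 < y by rewrite divr_gt0 ?subr_gt0// mulr_gt0.
  have e : w1 + n%:R * (2 * y) = w2 by rewrite /y; field; rewrite gt_eqF.
  have yy0 : y <= y0.
    move: nl; rewrite ler_pdivrMr ?mulr_gt0// /y ler_pdivrMr ?mulr_gt0//; lra.
  have := step y n y0' yy0; rewrite e lexx => /(_ isT n0) h.
  apply: le_trans h _; rewrite -subr_ge0.
  rewrite [X in 0 <= X](_ : _ = C ^+ 2 * K * (w2 - w1) ^+ 2 / (2 * n%:R)); last first.
    by rewrite /y; field; rewrite gt_eqF.
  by apply: divr_ge0; [exact: Q0|lra].
have mI : measurable (`[w1, w2]%classic : set (measurableTypeR R)) by [].
rewrite -(fineK (fin_num_measure nu _ mI)); congr (_%:E).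
apply/eqP; rewrite eq_le; apply/andP; split; last exact: fine_ge0.
apply/ler_addgt0Pl => e e0; rewrite addr0.
pose Q := C ^+ 2 * K * (w2 - w1) ^+ 2.
have [n nQ] : exists n : nat, Q / e + (w2 - w1) / (2 * y0) < n%:R.
  exists (Num.truncn (Q / e + (w2 - w1) / (2 * y0))).+1; exact: truncnS_gt.
have h1 : 0 <= Q / e by rewrite divr_ge0 ?(ltW e0).
have h2 : 0 < (w2 - w1) / (2 * y0) by rewrite divr_gt0 ?subr_gt0// mulr_gt0.
have nr : (0 : R) < n%:R by lra.
apply: le_trans (le_n n _ _) _; first by rewrite -(ltr0n R).
  by lra.
rewrite -/Q ler_pdivrMr// mulrC -ler_pdivrMr//; lra.
Qed.

Lemma same_law_dirac nu (c : R) : nu (~` [set c]) = 0%E -> same_law nu (dirac_law c).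
Proof.
move=> nc A mA; rewrite /dirac_law /= diracE.
have mc : measurable ([set c] : set (measurableTypeR R)) by exact: measurable_set1.
case: (boolP (c \in A)) => [|]; rewrite ?inE ?notin_setE => cA.
  have : nu (~` A) = 0%E.
    apply/eqP; rewrite eq_le measure_ge0 andbT.
    apply: (@le_trans _ _ (nu (~` [set c]))); last by rewrite nc.
    apply: le_measure; rewrite ?inE; [exact: measurableC..|].
    by move=> t /= At tc; apply: At; rewrite tc.
  have := probability_setC nu (measurableC mA); rewrite setCK => -> ->.
  by rewrite sube0.
apply/eqP; rewrite eq_le measure_ge0 andbT.
apply: (@le_trans _ _ (nu (~` [set c]))); last by rewrite nc.
apply: le_measure; rewrite ?inE//; first exact: measurableC.
by move=> t At /= tc; apply: cA; rewrite -tc.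
Qed.

Lemma null_intervals_dirac nu (c : R) :
  (forall w1 w2 : R, w1 < w2 -> w2 < c \/ c < w1 -> nu `[w1, w2]%classic = 0%E) ->
  same_law nu (dirac_law c).
Proof.
move=> H; apply: same_law_dirac.
pose I (n : nat) : set (measurableTypeR R) :=
  `[c + n.+1%:R^-1, c + n.+2%:R]%classic `|` `[c - n.+2%:R, c - n.+1%:R^-1]%classic.
have mI n : measurable (I n) by apply: measurableU.
have i1 (n : nat) : (n.+1%:R^-1 : R) < n.+2%:R.
  by apply: (@le_lt_trans _ _ 1); rewrite ?invf_le1 ?ler1n ?ltr1n.
have i0 (n : nat) : (0 : R) < n.+1%:R^-1 by rewrite invr_gt0.
have I0 n : nu (I n) = 0%E.
  apply/eqP; rewrite eq_le measure_ge0 andbT.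
  apply: le_trans; first by apply: measureU2.
  have i1n := i1 n; have i0n := i0 n.
  rewrite -[leRHS]adde0; apply: leeD; rewrite le_eqVlt; apply/orP; left; apply/eqP.
    by move: i1n i0n; move: (_^-1) (n.+2%:R) => u v uv u0; apply: H; [lra|right; lra].
  by move: i1n i0n; move: (_^-1) (n.+2%:R) => u v uv u0; apply: H; [lra|left; lra].
have [N [mN N0 IN]] : nu.-negligible (\bigcup_n I n).
  by apply: negligible_bigcup => n; exists (I n); split; [exact: mI|exact: I0|].
apply/eqP; rewrite eq_le measure_ge0 andbT.
apply: (@le_trans _ _ (nu N)); last by rewrite N0.
apply: le_measure; rewrite ?inE//; first by apply: measurableC; exact: measurable_set1.
apply: subset_trans IN; rewrite (_ : \bigcup_n I n = ~` [set c])//.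
apply/seteqP; split=> t.
  move=> [n _ []] /=; rewrite in_itv/= => /andP[h1 h2] tc;
    move: (i0 n) h1 h2; rewrite tc; move: (_^-1) => u; lra.
move=> /= tc; pose s := `|t - c|.
have s0 : 0 < s by rewrite normr_gt0 subr_eq0; apply/eqP.
pose n := Num.truncn (s + s^-1); exists n => //.
have ns : s + s^-1 < n.+1%:R by exact: truncnS_gt.
have si : 0 < s^-1 by rewrite invr_gt0.
have l1 : n.+1%:R^-1 <= s.
  by rewrite -[leRHS]invrK lef_pV2 ?posrE//; lra.
have l2 : s <= n.+2%:R by rewrite -natr1; lra.
move: l1 l2; rewrite /s /I; move: (n.+1%:R^-1) (n.+2%:R) => u v.
have [ct|ct] := leP c t.
  by rewrite ger0_norm ?subr_ge0// => l1 l2; left; rewrite /= in_itv/=; apply/andP; split; lra.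
rewrite ler0_norm; last by lra.
by move=> l1 l2; right; rewrite /= in_itv/=; apply/andP; split; lra.
Qed.

End dirac_criteria.

(** * An unbounded subordination function forces a Dirac measure *)

Section covering.
Context {R : realType} (mu : borel_prob R) (a b : R).
Hypothesis hab : a < b.
Hypothesis ha : (0 < mu [set a])%E.
Hypothesis hsum : (mu [set a] + mu `[b, +oo[%classic = 1)%E.
Hypothesis hlim : real_cauchy_transform mu x @[x --> b^'-] --> (0 : R).

Context (mu1 nu1 : borel_prob R).
Let U := re_recip nu1.
Let V := im_recip nu1.
Hypothesis subord : forall x y : R, 0 < y -> mean_im mu1 (U x y) (V x y) = mean_im mu x y.
Hypothesis V_le : forall x2, a < x2 -> x2 < b -> exists2 C : R, 0 < C &
  forall x y : R, x <= x2 -> 0 < y -> V x y <= C * y.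
Hypothesis U_right : forall M : R, exists x y0 : R, [/\ a < x, x < b, 0 < y0 &
  forall y : R, 0 < y -> y <= y0 -> M < U x y].

Let U_lip C x2 : (forall x y : R, x <= x2 -> 0 < y -> V x y <= C * y) ->
  forall x y x' y', x <= x2 -> x' <= x2 -> 0 < y -> 0 < y' ->
  `|U x y - U x' y'| <= C * (`|x - x'| + `|y - y'|).
Proof. by move=> h x y x' y' ? ? ? ?; apply: re_recip_lipschitz => //; exact: h. Qed.

(* The boundary value c of U at the atom: the function U(a + iy) is Lipschitz in y,
   so subtracting C y makes it nonincreasing and c is a supremum. *)
Let center : exists c C : R, 0 < C /\ forall y, 0 < y -> `|U a y - c| <= C * y.
Proof.
have [C C0 hC] : exists2 C : R, 0 < C &
    forall x y : R, x <= (a + b) / 2 -> 0 < y -> V x y <= C * y.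
  by have h := hab; apply: V_le; lra.
have am : a <= (a + b) / 2 by have h := hab; lra.
have lip (y y' : R) : 0 < y -> 0 < y' -> `|U a y - U a y'| <= C * `|y - y'|.
  move=> y0 y0'; have := U_lip hC (x := a) (x' := a) (y := y) (y' := y').
  by rewrite subrr normr0 add0r; apply.
pose E : set R := [set r | exists2 y, 0 < y & r = U a y - C * y].
have Eb (y' : R) : 0 < y' -> ubound E (U a y' + C * y').
  move=> y0' r [y y0 ->]; have := lip _ _ y0 y0'.
  rewrite ler_distl => /andP[_ h].
  have : `|y - y'| <= y + y' by rewrite ler_norml; apply/andP; split; lra.
  by rewrite -(ler_pM2l C0); lra.
have Es : has_sup E.
  split; first by exists (U a 1 - C * 1), 1.
  by exists (U a 1 + C * 1); exact: Eb.
exists (sup E), C; split=> // y y0.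
have h1 : U a y - C * y <= sup E by apply: ub_le_sup => //; [exact: Es.2|exists y].
have h2 : sup E <= U a y + C * y by apply: ge_sup; [exact: Es.1|exact: Eb].
by rewrite ler_norml; apply/andP; split; lra.
Qed.

Let U_continuous x2 x y : a < x2 -> x2 < b -> x < x2 -> 0 < y ->
  {for x, continuous (U^~ y)}.
Proof.
move=> ax2 x2b xx2 y0; have [C C0 hC] := V_le ax2 x2b.
apply/cvgrPdist_lt => e e0 /=.
near=> x'.
have h : x' <= x2 by apply: ltW; near: x'; exact: lt_nbhsl.
have := U_lip hC (ltW xx2) h y0 y0; rewrite subrr normr0 addr0 => /le_lt_trans; apply.
rewrite mulrC -ltr_pdivlMr//; near: x'.
by apply: cvgr_dist_lt; rewrite ?divr_gt0//; exact: cvg_id.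
Unshelve. all: by end_near. Qed.

(** Every real w is hit by U at each small height, at an abscissa x that stays
    away from the ray and, when w differs from the boundary value c at the atom,
    away from the atom as well.  There the subordination identity bounds the
    Poisson integral of mu1 by that of mu, which is bounded off its support. *)
Lemma subordinated_dirac : exists c, same_law mu1 (dirac_law c).
Proof.
have [c [C1 [C10 hc]]] := center; exists c.
apply: null_intervals_dirac => w1 w2 w12 cw.
have [eta eta0 heta] : exists2 eta : R, 0 < eta &
    forall w, w1 <= w -> w <= w2 -> eta <= `|w - c|.
  case: cw => cw; [exists (c - w2); first lra|exists (w1 - c); first lra].
    by move=> w h1 h2; rewrite distrC (le_trans _ (ler_norm _))//; lra.
  by move=> w h1 h2; rewrite (le_trans _ (ler_norm _))//; lra.
have [xr [yr [axr xrb yr0 hr]]] := U_right w2.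
pose x2 := (xr + b) / 2.
have xrx2 : xr < x2 by rewrite /x2; lra.
have x2b : x2 < b by rewrite /x2; lra.
have ax2 : a < x2 by lra.
have [C C0 hC] := V_le ax2 x2b.
have [xl [yl [xla yl0 hl]]] := @re_recip_left _ nu1 C a w1 C0
  (fun x y xa => hC x y (ltW (le_lt_trans xa ax2))).
(* U moves by at most C |x - a|, so a value at distance eta from c is only taken
   at distance eta / (2 C) from the atom; half of eta absorbs the height. *)
pose d := Num.min (eta / (2 * C)) (b - xr).
have d0 : 0 < d by rewrite lt_min divr_gt0 ?mulr_gt0//= subr_gt0.
pose y0 := Num.min (Num.min yl yr) (eta / (2 * C1)).
have y00 : 0 < y0 by rewrite !lt_min yl0 yr0 divr_gt0// mulr_gt0.
apply: (@null_interval _ mu1 w1 w2 y0 C ((d ^+ 2)^-1)) => //.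
  by rewrite invr_ge0 sqr_ge0.
move=> w y w1w ww2 yp; rewrite !le_min -andbA => /and3P[yyl yyr yeta].
have xlr : xl <= xr by lra.
have [x] : exists2 x, x \in `[xl, xr] & U x y = w.
  apply: IVT => //.
    apply: continuous_in_subspaceT => x; rewrite inE/= in_itv/= => /andP[_ xxr].
    by apply: (U_continuous ax2 x2b) => //; lra.
  have := hl y yp yyl; have := hr y yp yyr; rewrite -/(U xl y) => h1 h2.
  rewrite ge_min le_max; apply/andP; split; apply/orP; [left|right]; lra.
rewrite in_itv/= => /andP[xlx xxr] Uw.
have xx2 : x <= x2 by lra.
have Vy : y <= V x y by exact: im_recip_ge.
have V0 : 0 < V x y by lra.
exists (V x y); split=> //; first exact: hC.
have dxa : d <= `|x - a|.
  rewrite ge_min; apply/orP; left; rewrite ler_pdivrMr ?mulr_gt0//.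
  have h1 := U_lip hC xx2 (ltW ax2) yp yp.
  rewrite subrr normr0 addr0 Uw in h1.
  have h2 := hc y yp; have h3 := heta w w1w ww2.
  have h4 := ler_distD (U a y) w c.
  rewrite ler_pdivlMr ?mulr_gt0// in yeta.
  lra.
have := subord x yp; rewrite Uw => e.
rewrite mean_imE// [in RHS]mean_imE// in e.
have mP : mean_poisson mu x y <= (d ^+ 2)^-1.
  apply: (mean_poisson_le_dist hab hsum d0 dxa _ yp).
  have : d <= b - xr by rewrite ge_min lexx orbT.
  lra.
have P0 := mean_poisson_gt0 mu x yp.
apply: le_trans mP; rewrite -(ler_pM2l V0) e.
by rewrite ler_pM2r.
Qed.

End covering.

(** * Rank-one perturbations *)

Section rank_one.
Context {C : numClosedFieldType} (n : nat) (v al : 'I_n -> C) (c : C).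
Hypothesis v_real : forall k, v k \is Num.real.
Hypothesis al_real : forall k, al k \is Num.real.
Hypothesis c_real : c \is Num.real.

Let vec : 'cV[C]_n := \col_k v k.
Let B : 'M[C]_n := diag_mx (\row_k al k) + c *: (vec *m vec^T).

Let conj_vec : map_mx Num.conj vec = vec.
Proof. by apply/matrixP => i j; rewrite !mxE; exact/CrealP. Qed.

Let B_herm : B \is hermsymmx.
Proof.
apply: realsym_hermsym.
  apply/is_hermitianmxP; rewrite expr0 scale1r map_mx_id//.
  by rewrite /B linearD linearZ /= tr_diag_mx trmx_mul trmxK.
apply: realmxD; apply/mxOverP => i j; rewrite !mxE.
  by apply: rpredMn; exact: al_real.
rewrite !big_ord1 !mxE.
by rewrite !realM.
Qed.

(** In an eigenbasis of B = diag(al) + c v v^T the vector x = (z - diag(al))^-1 v,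
    which satisfies (z - B) x = (1 - c g) v with g = v^T x, has explicit coordinates;
    computing v^T x in that basis gives the identity.  The new weights are the
    squared moduli of the coordinates of v, so their sum is preserved. *)
Lemma rank_one_perturbation : exists lam wt : 'I_n -> C,
  [/\ forall j, lam j \is Num.real, forall j, 0 <= wt j,
      \sum_j wt j = \sum_k v k ^+ 2 &
      forall z, z \isn't Num.real ->
        let g := \sum_k v k ^+ 2 / (z - al k) in
        g = (1 - c * g) * \sum_j wt j / (z - lam j)].
Proof.
pose P := spectralmx B; pose D := spectral_diag B.
have PU : P \is unitarymx by exact: spectral_unitarymx.
have Pu : P \in unitmx by exact: spectral_unit.
have BE : B = invmx P *m diag_mx D *m P.
  by apply/orthomx_spectralP; exact: hermitian_normalmx.
have D_real j : D 0 j \is Num.real.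
  by have /mxOverP := hermitian_spectral_diag_real B_herm; apply.
pose u := P *m vec.
have dotE (x : 'cV[C]_n) : vec^T *m x = (map_mx Num.conj u)^T *m (P *m x).
  rewrite /u map_mxM conj_vec trmx_mul -!mulmxA; congr (_ *m _).
  rewrite mulmxA -[LHS]mul1mx; congr (_ *m _).
  have /unitarymxP := PU.
  by move/mulmx1C => <-; rewrite map_trmx.
exists (fun j : 'I_n => D 0 j); exists (fun j : 'I_n => Num.conj (u j 0) * u j 0); split=> //.
- by move=> j; rewrite mulrC mul_conjC_ge0.
- have := dotE vec; rewrite -/u => /(congr1 (fun M : 'M[C]_1 => M 0 0)).
  rewrite !mxE => e.
  transitivity (\sum_j (map_mx Num.conj u)^T 0 j * u j 0).
    by apply: eq_bigr => j _; rewrite !mxE.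
  by rewrite -e; apply: eq_bigr => j _; rewrite !mxE -expr2.
move=> z zr /=; set g := \sum_k _.
have zal k : z - al k != 0.
  by rewrite subr_eq0; apply: contraNneq zr => ->; exact: al_real.
have zD k : z - D 0 k != 0.
  by rewrite subr_eq0; apply: contraNneq zr => ->; exact: D_real.
pose x : 'cV[C]_n := \col_k (v k / (z - al k)).
have gE : vec^T *m x = g%:M.
  apply/matrixP => i j; rewrite !ord1 !mxE /= mulr1n; apply: eq_bigr => k _.
  by rewrite !mxE expr2 mulrA.
have xE : z *: x - B *m x = (1 - c * g) *: vec.
  rewrite /B mulmxDl -scalemxAl -mulmxA gE mul_mx_scalar mul_diag_mx.
  apply/matrixP => i j; rewrite !mxE.
  by field; exact: zal.
have yE j : (P *m x) j 0 = (1 - c * g) * u j 0 / (z - D 0 j).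
  have : z *: (P *m x) - diag_mx D *m (P *m x) = (1 - c * g) *: u.
    rewrite /u [RHS]scalemxAr -xE mulmxBr -scalemxAr BE; congr (_ - _).
    by rewrite !mulmxA mulmxV// mul1mx.
  move/matrixP => /(_ j 0); rewrite mul_diag_mx !mxE => <-.
  by field; exact: zD.
have : g%:M = (map_mx Num.conj u)^T *m (P *m x) :> 'M[C]_1 by rewrite -gE dotE.
move/matrixP => /(_ 0 0); rewrite !mxE /= mulr1n => gsum.
rewrite [LHS]gsum mulr_sumr; apply: eq_bigr => j _; rewrite yE [(_^T) _ _]mxE [(map_mx _ _) _ _]mxE.
by ring.
Qed.

End rank_one.

(** * Quantile functions *)

Section uniform_space.
Context {R : realType}.

Definition uniform01 : borel_prob R := uniform_prob (@ltr01 R).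

(** The open interval is the convenient one: a quantile function may be
    infinite at its end points. *)
Lemma uniform01E (A : set (measurableTypeR R)) : measurable A ->
  uniform01 A = lebesgue_measure (A `&` `]0, 1[%classic).
Proof.
move=> mA; have mI (b0 b1 : bool) :
    measurable (A `&` [set` Interval (BSide b0 0) (BSide b1 1)] : set (measurableTypeR R)).
  by apply: measurableI => //; exact: measurable_itv.
have -> : uniform01 A = lebesgue_measure (A `&` `[0, 1]%classic).
  rewrite /uniform01 /= /uniform_prob integral_uniform_pdf.
  rewrite (eq_integral (cst 1%E)); last first.
    by move=> x; rewrite inE/= => -[_]; rewrite in_itv/= /uniform_pdf => ->; rewrite subr0 invr1.
  by rewrite integral_cst ?mul1e//; exact: mI.
apply/eqP; rewrite eq_le; apply/andP; split; last first.
  apply: le_measure; rewrite ?inE; [exact: mI..|].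
  by move=> x /=; rewrite !in_itv/= => -[Ax /andP[/ltW-> /ltW->]].
apply: (@le_trans _ _ (lebesgue_measure ((A `&` `]0, 1[%classic) `|` ([set 0] `|` [set (1:R)])))).
  apply: le_measure; rewrite ?inE; [exact: mI|by apply: measurableU; [exact: mI|exact: measurableU]|].
  move=> x /=; rewrite !in_itv/= !le_eqVlt => -[Ax /andP[/orP[/eqP <-|->] /orP[/eqP->|->]]];
    by [right; left|right; right|left].
apply: le_trans; first by apply: measureU2; [exact: mI|exact: measurableU].
rewrite -[leRHS]adde0; apply: leeD => //.
apply: le_trans; first exact: measureU2.
rewrite -[leRHS]adde0; apply: leeD; rewrite le_eqVlt; apply/orP; left; apply/eqP;
  exact: lebesgue_measure_set1.
Qed.

Lemma uniform01_itv : uniform01 `]0, 1[%classic = 1%E.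
Proof.
by rewrite uniform01E// setIid lebesgue_measure_itv/= lte_fin ltr01 sube0.
Qed.

Lemma uniform01_set1 (u : R) : uniform01 [set u] = 0%E.
Proof.
rewrite uniform01E//; apply/eqP; rewrite eq_le measure_ge0 andbT.
rewrite -(lebesgue_measure_set1 u); apply: le_measure; rewrite ?inE//.
by apply: measurableI.
Qed.

Lemma uniform01_ae (P : R -> Prop) :
  (forall u, 0 < u -> u < 1 -> P u) -> {ae uniform01, forall u, P u}.
Proof.
move=> HP; exists (~` `]0, 1[%classic); split; first exact: measurableC.
  by have := probability_setC uniform01 (measurable_itv `]0, 1[); rewrite uniform01_itv subee.
move=> u /= nP; rewrite in_itv/= => /andP[u0 u1]; exact: nP (HP _ u0 u1).
Qed.

Lemma nondecreasing_on_measurable (f : R -> R) :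
  (forall u v, 0 < u -> u <= v -> v < 1 -> f u <= f v) ->
  measurable_fun [set: R] (f \_ `]0, 1[%classic).
Proof.
move=> ndf; apply/(measurable_restrictT _ (measurable_itv _)).
apply: (measurability (@RGenCInfty.G R)) => [|/= _ [_] [r] -> <-].
  exact: RGenCInfty.measurableE.
apply: is_interval_measurable => s t/=; rewrite !in_itv/= !andbT.
move=> [/andP[s0 s1] fs] [/andP[t0 t1] ft] u /andP[su ut].
split; first by rewrite in_itv/= (lt_le_trans s0 su) (le_lt_trans ut t1).
by rewrite in_itv/= andbT (le_trans fs)// ndf// (le_lt_trans ut).
Qed.

End uniform_space.

Section image_law.
Context {R : realType} (q : measurableTypeR R -> measurableTypeR R).
Hypothesis mq : measurable_fun setT q.

#[local] HB.instance Definition _ := @isMeasurableFun.Build _ _ _ _ q mq.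

Let X : {mfun (measurableTypeR R) >-> (measurableTypeR R)} := q.

Lemma image_law_exists : exists rho : borel_prob R,
  (forall A, measurable A -> rho A = uniform01 (q @^-1` A)) /\
  (forall h, bounded_meas h -> \int[rho]_t h t = \int[uniform01]_u h (q u)).
Proof.
exists (distribution uniform01 X : borel_prob R); split=> // h bh.
rewrite /Rintegral; congr fine.
apply: (@integral_distribution _ _ _ _ _ uniform01 X (EFin \o h)).
  by apply/measurable_EFinP; exact: bh.1.
have [mh [M hM]] := bh.
apply: (@bounded_meas_integrable _ uniform01 (fun u => h (q u))); split.
  exact: measurableT_comp.
by exists M => u; exact: hM.
Qed.

End image_law.

Lemma cdf_determines_law {R : realType} (mu nu : borel_prob R) :
  (forall s : R, mu `]-oo, s]%classic = nu `]-oo, s]%classic) ->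
  forall A, measurable A -> mu A = nu A.
Proof.
move=> H; have K := @measure_unique _ R (measurableTypeR R) (@ocitv R)
  (fun n => `]- n%:R, n%:R]%classic).
apply: (K _ _ _ _ mu nu) => {K} //.
- exact: ocitvI.
- by move=> n; exact: is_ocitv.
- rewrite -subTset => x _; exists (Num.truncn `|x|).+1 => //=.
  have := truncnS_gt `|x|; rewrite ltr_norml in_itv/= => /andP[-> /ltW ->] //.
- move=> A [[a b] /= _ <-].
  have [ab|ba] := ltP a b; last by rewrite set_itv_ge ?measure0// bnd_simp -leNgt.
  have -> : `]a, b]%classic = `]-oo, b]%classic `\` `]-oo, a]%classic :> set R.
    by rewrite -[RHS]setCK setCD setCitvl setUC -[LHS]setCK setCitv.
  have D (m : borel_prob R) : (m (`]-oo, b]%classic `\` `]-oo, a]%classic) =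
      m `]-oo, b]%classic - m `]-oo, a]%classic)%E.
    rewrite measureD//; last by rewrite (le_lt_trans (probability_le1 m _)) ?ltry.
    by rewrite setIidr//; apply: subset_itvl; rewrite bnd_simp ltW.
  by rewrite !D !H.
by move=> n; rewrite (le_lt_trans (probability_le1 _ _)) ?ltry.
Qed.

Section quantile.
Context {R : realType} (nu : borel_prob R).

Let idR : measurableTypeR R -> R := idfun.

#[local] HB.instance Definition _ :=
  @isMeasurableFun.Build _ _ _ _ idR (@measurable_id _ _ setT).

Let H (s : R) : R := fine (cdf (idR : {RV nu >-> R}) s).

Let HE s : nu `]-oo, s]%classic = (H s)%:E.
Proof. by rewrite /H fineK// fin_num_measure. Qed.

Let H_nd s t : s <= t -> H s <= H t.
Proof. by move=> st; rewrite fine_le ?fin_num_measure// cdf_nondecreasing. Qed.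

Let H_rc s : H x @[x --> s^'+] --> H s.
Proof.
by apply: fine_cvg; rewrite fineK ?fin_num_measure//; exact: cdf_right_continuous.
Qed.

Let H_Ny0 : H x @[x --> -oo] --> (0 : R).
Proof. exact/fine_cvg/cvg_cdfNy0. Qed.

Let H_y1 : H x @[x --> +oo] --> (1 : R).
Proof. exact/fine_cvg/cvg_cdfy1. Qed.

Let q (u : R) : R := inf [set s | u <= H s].

Let q_inf u : 0 < u -> u < 1 -> has_inf [set s | u <= H s].
Proof.
move=> u0 u1; split.
  have : \forall x \near +oo, u < H x by exact: cvgr_gt H_y1 _ u1.
  by move=> /filter_ex[x ux]; exists x => /=; exact: ltW.
have : \forall x \near -oo, H x < u by exact: cvgr_lt H_Ny0 _ u0.
move=> /filter_ex[x xu]; exists x => y /= uy.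
by rewrite leNgt; apply/negP => yx; have := H_nd (ltW yx); lra.
Qed.

Let q_galois u s : 0 < u -> u < 1 -> (q u <= s) = (u <= H s).
Proof.
move=> u0 u1; have hi := q_inf u0 u1; apply/idP/idP => [qs|us]; last first.
  by apply: ge_inf => //; exact: hi.2.
apply: le_trans (H_nd qs).
rewrite leNgt; apply/negP => Hu.
have : \forall x \near (q u)^'+, H x < u by exact: cvgr_lt (@H_rc (q u)) _ Hu.
move=> /(filterI (nbhs_right_gt (q u))) /filter_ex [x [qx Hxu]].
have [y /= uy yx] : exists2 y, u <= H y & y < x.
  by have [y] := inf_lt hi.1 qx; exists y.
by have := H_nd (ltW yx); lra.
Qed.

(** Inverse transform sampling.  Right continuity of the distribution function
    makes the quantile function its adjoint, and the adjunction computes the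
    image of the uniform law. *)
Lemma quantile_exists : exists q : R -> R,
  [/\ measurable_fun [set: R] q,
      forall u s, 0 < u -> u < 1 -> (q u <= s) = (u <= fine (nu `]-oo, s]%classic)) &
      forall h, bounded_meas h -> \int[uniform01]_u h (q u) = \int[nu]_t h t].
Proof.
have q_nd u v : 0 < u -> u <= v -> v < 1 -> q u <= q v.
  move=> u0 uv v1; rewrite q_galois//; last by lra.
  by apply: (le_trans uv); rewrite -q_galois//; lra.
pose Q := q \_ `]0, 1[%classic.
have QE u : 0 < u -> u < 1 -> Q u = q u.
  by move=> u0 u1; rewrite /Q patchE mem_set//= in_itv/= u0 u1.
have mQ : measurable_fun [set: R] Q by exact: nondecreasing_on_measurable.
have Qg u s : 0 < u -> u < 1 -> (Q u <= s) = (u <= H s).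
  by move=> u0 u1; rewrite QE// q_galois.
have [rho [rhoA rhoh]] := image_law_exists mQ.
exists Q; split=> // h bh; rewrite -rhoh//.
have E : forall A, measurable A -> rho A = nu A.
  apply: cdf_determines_law => s; rewrite rhoA// HE.
  have H0 : 0 <= H s by exact: fine_ge0.
  have H1 : H s <= 1 by rewrite -lee_fin -HE probability_le1.
  have mpre : measurable (Q @^-1` `]-oo, s]%classic : set (measurableTypeR R)).
    by rewrite -[X in measurable X]setTI; apply: mQ.
  rewrite uniform01E//.
  have -> : Q @^-1` `]-oo, s]%classic `&` `]0, 1[%classic =
     `]0, H s]%classic `&` `]0, 1[%classic.
    apply/seteqP; split=> u /=; rewrite !in_itv/= => -[h1 /andP[u0 u1]].
      by rewrite -Qg// h1 u0.
    by rewrite Qg// u0 u1; have /andP[_ ->] := h1.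
  have [h1|h1] := ltP (H s) 1.
    rewrite setIidl; last first.
      by move=> u /=; rewrite !in_itv/= => /andP[-> /le_lt_trans ->].
    rewrite lebesgue_measure_itv/= lte_fin.
    by case: ltP => H00; rewrite ?sube0//; congr (_%:E); lra.
  rewrite setIidr; last first.
    by move=> u /=; rewrite !in_itv/= => /andP[-> /ltW /le_trans ->].
  rewrite lebesgue_measure_itv/= lte_fin ltr01 sube0; congr (_%:E); lra.
rewrite /Rintegral; congr fine; apply: eq_measure_integral => A mA _; exact: E.
Qed.
End quantile.

(** * Helly's selection principle *)

Section helly.
Context {R : realType}.
Variable q : nat -> R -> R.
Hypothesis q_nd : forall n u v, 0 < u -> u <= v -> v < 1 -> q n u <= q n v.
Hypothesis q_bounded : forall u, 0 < u -> u < 1 ->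
  exists M : R, \forall n \near \oo, `|q n u| <= M.

(* Limits along a fixed ultrafilter exist without passing to a subsequence. *)
Let ultra_limit : exists (G : set_system nat) (Q : R -> R), [/\ ProperFilter G,
  forall P : set nat, (\forall n \near \oo, P n) -> G P,
  forall u v, 0 < u -> u <= v -> v < 1 -> Q u <= Q v &
  forall u e, 0 < u -> u < 1 -> 0 < e -> G [set n | `|q n u - Q u| < e]].
Proof.
have [G [UG sG]] := @ultraFilterLemma nat (nbhs \oo) _.
have PG : ProperFilter G by exact: ultra_proper.
pose S u : set R := [set s | G [set n | s <= q n u]].
have S_sup u : 0 < u -> u < 1 -> has_sup (S u).
  move=> u0 u1; have [M /sG hM] := q_bounded u0 u1.
  split; first by exists (- M); apply: filterS hM => n; rewrite ler_norml => /andP[].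
  exists M => s /= Gs; have [n [/= h1 h2]] := filter_ex (filterI Gs hM).
  by move: h2; rewrite ler_norml => /andP[_]; exact: le_trans.
exists G, (fun u => sup (S u)); split => //.
- move=> u v u0 uv v1.
  have u1 := le_lt_trans uv v1; have v0 := lt_le_trans u0 uv.
  apply: ge_sup; first exact: (S_sup _ u0 u1).1.
  move=> s /= Gs; apply: ub_le_sup; first exact: (S_sup _ v0 v1).2.
  by apply: filterS Gs => n /= /le_trans; apply; exact: q_nd.
move=> u e u0 u1 e0; set l := sup (S u).
have Glow : G [set n | l - e / 2 <= q n u].
  have [|s /= Gs ls] := @sup_gt R (S u) (l - e / 2) (S_sup _ u0 u1).1.
    by rewrite -/l; lra.
  by apply: filterS Gs => n /=; apply: le_trans; exact: ltW.
have Gup : G [set n | q n u < l + e / 2].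
  have [h|h] := in_ultra_setVsetC [set n | l + e / 2 <= q n u] UG.
    suff : l + e / 2 <= l by lra.
    by apply: ub_le_sup; [exact: (S_sup _ u0 u1).2|exact: h].
  by apply: filterS h => n /= /negP; rewrite -ltNge.
apply: filterS (filterI Glow Gup) => n /= [h1 h2].
by rewrite ltr_norml; apply/andP; split; lra.
Qed.

(** At each stage the ultrafilter contains an index that is good for finitely
    many rationals at once. *)
Lemma helly_selection : exists (s : nat -> nat) (Q : R -> R),
  [/\ forall k, (k <= s k)%N,
      forall u v, 0 < u -> u <= v -> v < 1 -> Q u <= Q v &
      forall r : rat, 0 < ratr r :> R -> ratr r < 1 :> R ->
        q (s k) (ratr r) @[k --> \oo] --> Q (ratr r)].
Proof.
have [G [Q [PG sG Q_nd hG]]] := ultra_limit.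
pose good k n := (k <= n)%N /\ forall i, (i <= k)%N -> forall r : rat,
  unpickle i = Some r -> 0 < ratr r :> R -> ratr r < 1 :> R ->
  `|q n (ratr r) - Q (ratr r)| < k.+1%:R^-1.
have exgood k : exists n, good k n.
  have G1 : G [set n | (k <= n)%N] by apply: sG; exact: nbhs_infty_ge.
  have G2 m : G [set n | forall i, (i < m)%N -> forall r : rat,
     unpickle i = Some r -> 0 < ratr r :> R -> ratr r < 1 :> R ->
     `|q n (ratr r) - Q (ratr r)| < k.+1%:R^-1].
    elim: m => [|m IH]; first by apply: filterS G1 => n _ i; rewrite ltn0.
    have Gm : G [set n | forall r : rat,
       unpickle m = Some r -> 0 < ratr r :> R -> ratr r < 1 :> R ->
       `|q n (ratr r) - Q (ratr r)| < k.+1%:R^-1].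
      case: (unpickle m) => [r|]; last by apply: filterS G1.
      have [/andP[r0 r1]|nr] := boolP ((0 < ratr r :> R) && (ratr r < 1 :> R)).
        have := hG _ (k.+1%:R^-1) r0 r1; rewrite invr_gt0 ltr0n => /(_ isT).
        by apply: filterS => n h r' [<-].
      by apply: filterS G1 => n _ r' [<-] r0 r1; move: nr; rewrite r0 r1.
    apply: filterS (filterI IH Gm) => n /= [h1 h2] i.
    by rewrite ltnS leq_eqVlt => /orP[/eqP -> //|]; exact: h1.
  by have [n [h1 h2]] := filter_ex (filterI G1 (G2 k.+1)); exists n; split.
have [s hs] := choice exgood; exists s, Q; split=> //.
  by move=> k; exact: (hs k).1.
move=> r r0 r1; apply/cvgrPdist_lt => e e0.
near=> k.
rewrite distrC; apply: (@lt_trans _ _ k.+1%:R^-1).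
  apply: ((hs k).2 (pickle r)); rewrite ?pickleK//.
  by near: k; exact: nbhs_infty_ge.
by near: k; exact: near_infty_natSinv_lt (PosNum e0).
Unshelve. all: by end_near. Qed.

End helly.

(** * Weak compactness *)

Section monotone_limits.
Context {R : realType} (g : nat -> R -> R) (Q : R -> R).
Hypothesis g_nd : forall k u v, 0 < u -> u <= v -> v < 1 -> g k u <= g k v.
Hypothesis Q_nd : forall u v, 0 < u -> u <= v -> v < 1 -> Q u <= Q v.
Hypothesis g_cvg : forall r : rat, 0 < ratr r :> R -> ratr r < 1 :> R ->
  g k (ratr r) @[k --> \oo] --> Q (ratr r).

(* The points across which Q jumps over the interval from ratr s to ratr t. *)
Let jump (st : rat * rat) : set (measurableTypeR R) :=
  [set u | [/\ 0 < u, u < 1, (ratr st.1 : R) < ratr st.2,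
     forall v, 0 < v -> v < u -> Q v <= ratr st.1 &
     forall v, u < v -> v < 1 -> ratr st.2 <= Q v]].

Let jump_null st : uniform01.-negligible (jump st).
Proof.
have [->|] := eqVneq (jump st) set0; first exact: negligible_set0.
move=> /set0P[u ju]; exists [set u]; split.
- exact: measurable_set1.
- exact: uniform01_set1.
move=> u' ju' /=.
have uniq (x y : R) : jump st x -> jump st y -> x < y -> False.
  move=> [x0 _ st12 _ hx] [_ y1 _ hy _] xy.
  have h1 := hx ((x + y) / 2) (ltac:(lra)) (ltac:(lra)).
  have h2 := hy ((x + y) / 2) (ltac:(lra)) (ltac:(lra)).
  lra.
by have [lt|lt|//] := ltgtP u u'; exfalso; [exact: uniq ju ju' lt|exact: uniq ju' ju lt].
Qed.

(** Convergence can only fail at a jump of the limit.  A jump leaps over an interval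
    with rational end points, and at most one point does so for each of them, so
    the exceptional set is a countable union of null sets. *)
Lemma monotone_ae_cvg :
  {ae uniform01, forall u, 0 < u -> u < 1 -> g k u @[k --> \oo] --> Q u}.
Proof.
have N : uniform01.-negligible (\bigcup_i
    (if unpickle i is Some st then jump st else set0)).
  by apply: negligible_bigcup => i; case: unpickle => [st|]; [exact: jump_null|exact: negligible_set0].
apply: negligibleS N => u /= nP; apply: contrapT => nJ; apply: nP => u0 u1.
have noj st : ~ jump st u.
  move=> j; apply: nJ; exists (pickle st); first exact: I.
  by rewrite pickleK; exact: j.
have left e : 0 < e -> exists2 v, 0 < v < u & Q u - e < Q v.
  move=> e0; apply: contrapT => nex.
  have [t] : exists2 t : rat, (Q u - e / 2 : R) < ratr t & ratr t < Q u.
    have [t] := @rat_in_itvoo R (Q u - e / 2) (Q u) (ltac:(lra)).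
    by rewrite in_itv/= => /andP[]; exists t.
  have [s] : exists2 s : rat, (Q u - e : R) < ratr s & ratr s < Q u - e / 2.
    have [s] := @rat_in_itvoo R (Q u - e) (Q u - e / 2) (ltac:(lra)).
    by rewrite in_itv/= => /andP[]; exists s.
  move=> s1 s2 t1 t2; apply: (noj (s, t)); split=> //=; first lra.
    move=> v v0 vu; rewrite leNgt; apply/negP => sv; apply: nex.
    by exists v; [rewrite v0 vu|lra].
  by move=> v uv v1; apply: le_trans (ltW t2) _; apply: Q_nd => //; exact: ltW.
have right e : 0 < e -> exists2 v, u < v < 1 & Q v < Q u + e.
  move=> e0; apply: contrapT => nex.
  have [s] : exists2 s : rat, (Q u : R) < ratr s & ratr s < Q u + e / 2.
    have [s] := @rat_in_itvoo R (Q u) (Q u + e / 2) (ltac:(lra)).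
    by rewrite in_itv/= => /andP[]; exists s.
  have [t] : exists2 t : rat, (Q u + e / 2 : R) < ratr t & ratr t < Q u + e.
    have [t] := @rat_in_itvoo R (Q u + e / 2) (Q u + e) (ltac:(lra)).
    by rewrite in_itv/= => /andP[]; exists t.
  move=> t1 t2 s1 s2; apply: (noj (s, t)); split=> //=; first lra.
    by move=> v v0 vu; apply: le_trans (ltW s1); apply: Q_nd => //; exact: ltW.
  move=> v uv v1; rewrite leNgt; apply/negP => vt; apply: nex.
  by exists v; [rewrite uv v1|lra].
apply/cvgrPdist_lt => e e0.
have [v /andP[v0 vu] Qv] := left _ (ltac:(lra) : 0 < e / 2).
have [w /andP[uw w1] Qw] := right _ (ltac:(lra) : 0 < e / 2).
have [r] := @rat_in_itvoo R v u vu; rewrite in_itv/= => /andP[vr ru].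
have [r'] := @rat_in_itvoo R u w uw; rewrite in_itv/= => /andP[ur' r'w].
have r0 : 0 < ratr r :> R by lra. have r1 : ratr r < 1 :> R by lra.
have r0' : 0 < ratr r' :> R by lra. have r1' : ratr r' < 1 :> R by lra.
have h1 : Q u - e < Q (ratr r) - e / 2.
  by have := Q_nd v0 (ltW vr) r1; lra.
have h2 : Q (ratr r') + e / 2 < Q u + e.
  by have := Q_nd r0' (ltW r'w) w1; lra.
near=> k.
have c1 : `|Q (ratr r) - g k (ratr r)| < e / 2.
  by near: k; apply: cvgr_dist_lt; [exact: g_cvg|lra].
have c2 : `|Q (ratr r') - g k (ratr r')| < e / 2.
  by near: k; apply: cvgr_dist_lt; [exact: g_cvg|lra].
have m1 := g_nd k r0 (ltW ru) u1; have m2 := g_nd k u0 (ltW ur') r1'.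
move: c1 c2; rewrite !ltr_norml => /andP[? ?] /andP[? ?].
by apply/andP; split; lra.
Unshelve. all: by end_near. Qed.

End monotone_limits.

(** Prokhorov's theorem on the line.  Tightness says that the quantile functions
    are bounded at each point, and the image of the uniform law under the limit
    of a subsequence is the weak limit. *)
Lemma tight_subsequence {R : realType} (rho : nat -> borel_prob R) :
  (forall e : R, 0 < e -> exists T : R, \forall n \near \oo,
     fine (rho n `]-oo, - T]%classic) < e /\
     1 - e < fine (rho n `]-oo, T]%classic)) ->
  exists (s : nat -> nat) (rho0 : borel_prob R), (forall k, (k <= s k)%N) /\
    forall h : R -> R, continuous h -> bounded_meas h ->
      \int[rho (s k)]_t h t @[k --> \oo] --> \int[rho0]_t h t.
Proof.
move=> tight.
have [q hq] := choice (fun n => quantile_exists (rho n)).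
have q_nd n u v : 0 < u -> u <= v -> v < 1 -> q n u <= q n v.
  move=> u0 uv v1; have [_ gal _] := hq n.
  rewrite gal//; last by lra.
  by apply: (le_trans uv); rewrite -gal//; lra.
have q_bd u : 0 < u -> u < 1 -> exists M : R, \forall n \near \oo, `|q n u| <= M.
  move=> u0 u1; pose e := Num.min u (1 - u).
  have e0 : 0 < e by rewrite lt_min u0 subr_gt0.
  have eu : e <= u by rewrite ge_min lexx.
  have eu' : e <= 1 - u by rewrite ge_min lexx orbT.
  have [T hT] := tight e e0; exists T.
  apply: filterS hT => n [h1 h2]; have [_ gal _] := hq n.
  rewrite ler_norml; apply/andP; split.
    by apply/ltW; rewrite ltNge gal//; apply/negP; lra.
  by rewrite gal//; lra.
have [s [Q [hs Q_nd cvQ]]] := helly_selection q_nd q_bd.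
pose Q' := Q \_ `]0, 1[%classic.
have mQ : measurable_fun [set: R] Q' by exact: nondecreasing_on_measurable.
have [rho0 [_ hrho0]] := image_law_exists mQ.
exists s, rho0; split=> // h ch bh; rewrite hrho0//.
have -> : (fun k => \int[rho (s k)]_t h t) = (fun k => \int[uniform01]_u h (q (s k) u)).
  by apply/funext => k; have [_ _ ->] := hq (s k).
have [mh [M hM]] := bh.
apply: (@bounded_convergence _ _ _ _ _ _ M) => //.
- by move=> k; apply: measurableT_comp => //; have [] := hq (s k).
- exact: measurableT_comp.
have ae1 := monotone_ae_cvg (fun k => @q_nd (s k)) Q_nd cvQ.
have ae2 : {ae @uniform01 R, forall u, 0 < u < 1}.
  by apply: uniform01_ae => u -> ->.
apply: ae_imply2 ae1 ae2 => u cu /andP[u0 u1].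
rewrite /Q' patchE mem_set/= ?in_itv/= ?u0 ?u1//.
by apply: (cvg_comp _ _ (cu u0 u1)); exact: ch.
Qed.

(** * Discrete measures *)

Import HBSimple.

Section discrete_laws.
Context {R : realType}.

Lemma bounded_meas_sum (n : nat) (h : 'I_n -> R -> R) :
  (forall j, bounded_meas (h j)) -> bounded_meas (fun t => \sum_j h j t).
Proof.
elim: n h => [|n IH] h bh.
  rewrite (_ : (fun _ => _) = fun=> 0); last by apply/funext => t; rewrite big_ord0.
  exact: bounded_meas_cst.
rewrite (_ : (fun _ => _) = fun t => \sum_(j < n) h (widen_ord (leqnSn n) j) t + h ord_max t).
  by apply: bounded_measD; first exact: IH.
by apply/funext => t; rewrite big_ord_recr.
Qed.

Lemma mean_sum (nu : borel_prob R) (n : nat) (h : 'I_n -> R -> R) :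
  (forall j, bounded_meas (h j)) ->
  \int[nu]_t (\sum_j h j t) = \sum_j \int[nu]_t h j t.
Proof.
elim: n h => [|n IH] h bh.
  rewrite big_ord0; under eq_Rintegral do rewrite big_ord0.
  exact: mean_cst.
rewrite big_ord_recr -IH//= -meanD//; last exact: bounded_meas_sum.
by apply: eq_Rintegral => t _; rewrite big_ord_recr.
Qed.

(** A normalized sum of Dirac masses.  The normalization changes nothing and only
    serves to obtain a probability. *)
Lemma discrete_law (n : nat) (w al : 'I_n -> R) :
  (forall j, 0 <= w j) -> \sum_j w j = 1 ->
  exists rho : borel_prob R, forall h, bounded_meas h ->
    \int[rho]_t h t = \sum_j w j * h (al j).
Proof.
move=> w0 w1.
pose wk (k : nat) : R := oapp w 0 (insub k).
pose ak (k : nat) : R := oapp al 0 (insub k).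
have wk0 k : 0 <= wk k by rewrite /wk; case: insub => //=.
have wjE j : wk (val j) = w j.
  by rewrite /wk insubT//= => p; congr w; exact: val_inj.
have ajE j : ak (val j) = al j.
  by rewrite /ak insubT//= => p; congr al; exact: val_inj.
pose m : {measure set (measurableTypeR R) -> \bar R} :=
  msum (fun k => mscale (NngNum (wk0 k)) (@dirac _ (measurableTypeR R) (ak k) R)) n.
have mE A : m A = (\sum_j (w j)%:E * \d_(al j) A)%E.
  rewrite /m /= /msum; apply: eq_bigr => j _.
  by transitivity ((wk j)%:E * \d_(ak j) A)%E; rewrite // wjE ajE.
have mT : m setT = 1%E.
  rewrite mE; under eq_bigr do rewrite diracT mule1.
  by rewrite sumEFin w1.
pose rho : borel_prob R := mnormalize m (@dirac _ (measurableTypeR R) 0 R).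
have rhoE A : measurable A -> A `<=` setT -> rho A = m A.
  by move=> _ _; rewrite /rho /= /mnormalize mT onee_eq0 /= invr1 mule1.
have ge0_case (h : R -> R) : measurable_fun setT h -> (forall t, 0 <= h t) ->
    \int[rho]_t h t = \sum_j w j * h (al j).
  move=> mh h0; rewrite /Rintegral (eq_measure_integral m rhoE).
  have mEh : measurable_fun setT (fun t : measurableTypeR R => (h t)%:E).
    exact/measurable_EFinP.
  rewrite ge0_integral_measure_sum//; last by move=> t _; rewrite lee_fin.
  rewrite (eq_bigr (fun j : 'I_n => (w j * h (al j))%:E)) ?sumEFin// => j _.
  rewrite ge0_integral_mscale//; last by move=> t _; rewrite lee_fin.
  rewrite integral_dirac// diracT mul1e -EFinM /= wjE ajE.
  by [].
exists rho => h bh; have [mh [M hM]] := bh.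
have := ge0_case (fun t => h t + M) _ _; rewrite meanD//; last exact: bounded_meas_cst.
rewrite mean_cst; under eq_bigr do rewrite mulrDr.
rewrite big_split /= -mulr_suml w1 mul1r => H; apply: (addIr M); apply: H.
  by apply: measurable_funD.
by move=> t; have := hM t; rewrite ler_norml; lra.
Qed.

(** The image laws of simple functions that converge pointwise to the identity. *)
Lemma discrete_approximation (nu : borel_prob R) :
  exists (m : nat -> nat) (w al : forall k, 'I_(m k) -> R),
  [/\ forall k j, 0 <= w k j, forall k, \sum_j w k j = 1 &
    forall h, continuous h -> bounded_meas h ->
      \sum_j w k j * h (al k j) @[k --> \oo] --> \int[nu]_t h t].
Proof.
have [g gcvg] := @approximation_sfun _ (measurableTypeR R) R (fun t => t%:E) setT measurableT
  ltac:(exact/measurable_EFinP).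
have [ys hys] : exists ys : nat -> seq R, forall k, uniq (ys k) /\
    forall t, g k t \in ys k.
  suff H k : exists s : seq R, uniq s /\ forall t, g k t \in s.
    by have [ys hys] := choice H; exists ys.
  have /finite_seqP[s sE] : finite_set (range (g k)) by exact: fimfunP.
  exists (undup s); split=> [|t]; first exact: undup_uniq.
  by rewrite mem_undup; have : [set` s] (g k t) by rewrite -sE; exists t.
pose m k := size (ys k).
pose al k (j : 'I_(m k)) : R := nth 0 (ys k) j.
pose w k (j : 'I_(m k)) : R := fine (nu (g k @^-1` [set al k j])).
have mg k y : measurable (g k @^-1` [set y] : set (measurableTypeR R)).
  by rewrite -[X in measurable X]setTI; apply: (measurable_funPT (g k)).
have bi k y : bounded_meas (\1_(g k @^-1` [set y]) : R -> R).
  split; first by apply: measurable_indic; exact: mg.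
  by exists 1 => t; rewrite indicE; case: (_ \in _); rewrite ?normr0 ?normr1.
have gsum k (h : R -> R) t : h (g k t) = \sum_j h (al k j) * \1_(g k @^-1` [set al k j]) t.
  have gin := (hys k).2 t.
  have ilt : (index (g k t) (ys k) < m k)%N by rewrite index_mem.
  rewrite (bigD1 (Ordinal ilt))//= big1 ?addr0 => [|j jne].
    by rewrite /al /= nth_index// indicE mem_set//= mulr1.
  rewrite indicE memNset ?mulr0//= => gj; case/negP: jne; apply/eqP/val_inj => /=.
  by rewrite gj /al index_uniq//; exact: (hys k).1.
have sumE k (h : R -> R) : \sum_j w k j * h (al k j) = \int[nu]_t h (g k t).
  transitivity (\int[nu]_t (\sum_j h (al k j) * \1_(g k @^-1` [set al k j]) t)); last first.
    by apply: eq_Rintegral => t _; rewrite -gsum.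
  rewrite mean_sum; last by move=> j; exact: bounded_measZ.
  apply: eq_bigr => j _; rewrite (meanZ nu _ (bi k (al k j))) mulrC; congr (_ * _).
  by rewrite /Rintegral integral_indic// setIT.
exists m, w, al; split.
- by move=> k j; exact: fine_ge0.
- move=> k; have := sumE k (fun=> 1); rewrite mean_cst => <-.
  by apply: eq_bigr => j _; rewrite mulr1.
move=> h ch bh; have [mh [M hM]] := bh.
have -> : (fun k => \sum_j w k j * h (al k j)) = (fun k => \int[nu]_t h (g k t)).
  by apply/funext => k; exact: sumE.
apply: (@bounded_convergence _ _ _ _ _ _ M) => //.
  by move=> k; apply: measurableT_comp => //; exact: (measurable_funPT (g k)).
apply: aeW => t; have := gcvg t I => /fine_cvg /= H.
by apply: (cvg_comp _ _ H); exact: ch.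
Qed.

End discrete_laws.

(** * Adding a constant to the reciprocal Cauchy transform *)

Section discrete_shift.
Local Open Scope complex_scope.
Context {R : realType}.

Lemma complex_sum (n : nat) (p q : 'I_n -> R) :
  \sum_j (p j +i* q j) = (\sum_j p j) +i* (\sum_j q j).
Proof.
elim: n p q => [|n IH] p q; first by rewrite !big_ord0.
by rewrite !big_ord_recr/= IH.
Qed.

Lemma inv_sub_real (x y t : R) :
  (x +i* y - t%:C)^-1 = re_kernel x y t +i* - im_kernel x y t.
Proof. by rewrite /re_kernel /im_kernel /sqdist /GRing.inv /= subr0. Qed.

Lemma weighted_resolvent (n : nat) (w al : 'I_n -> R) (x y : R) :
  \sum_j (w j)%:C / (x +i* y - (al j)%:C) =
  (\sum_j w j * re_kernel x y (al j)) +i* - (\sum_j w j * im_kernel x y (al j)).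
Proof.
rewrite -sumrN -complex_sum; apply: eq_bigr => j _.
rewrite inv_sub_real; apply/eqP; rewrite eq_complex /=.
by rewrite !mul0r subr0 addr0 mulrN !eqxx.
Qed.

(** The right-hand sides are the real part and minus the imaginary part of
    G/(1 - cG), where G = A - iB. *)
Lemma discrete_shift (n : nat) (w al : 'I_n -> R) (c : R) :
  (forall j, 0 <= w j) -> \sum_j w j = 1 ->
  exists rho : borel_prob R, forall x y : R, 0 < y ->
    let A := \sum_j w j * re_kernel x y (al j) in
    let B := \sum_j w j * im_kernel x y (al j) in
    let N := (1 - c * A) ^+ 2 + (c * B) ^+ 2 in
    mean_re rho x y = (A - c * (A ^+ 2 + B ^+ 2)) / N /\ mean_im rho x y = B / N.
Proof.
move=> w0 w1.
have real_real (r : R) : r%:C \is Num.real by apply/complex_realP; exists r.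
have [lam [wt [lam_real wt0 wt1 H]]] := @rank_one_perturbation R[i] n
  (fun j => (Num.sqrt (w j))%:C) (fun j => (al j)%:C) c%:C
  (fun j => real_real _) (fun j => real_real _) (real_real _).
pose l j := complex.Re (lam j); pose r j := complex.Re (wt j).
have lE j : lam j = (l j)%:C by rewrite /l RRe_real.
have rE j : wt j = (r j)%:C by rewrite /r RRe_real// ger0_real.
have r0 j : 0 <= r j by have := wt0 j; rewrite lecE => /andP[].
have sqE j : (Num.sqrt (w j))%:C ^+ 2 = (w j)%:C.
  by rewrite -rmorphXn sqr_sqrtr.
have sumC (u : 'I_n -> R) : \sum_j (u j)%:C = (\sum_j u j)%:C by rewrite rmorph_sum.
have r1 : \sum_j r j = 1.
  apply: (@complexI R); rewrite -sumC -w1 -sumC.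
  rewrite -(eq_bigr _ (fun j _ => rE j)) wt1.
  by apply: eq_bigr => j _; rewrite sqE.
have [rho hrho] := @discrete_law R n r l r0 r1.
exists rho => x y y0 A B N.
have nreal : (x +i* y) \isn't Num.real by rewrite complex_real gt_eqF.
have := H _ nreal => /=.
have -> : \sum_k (Num.sqrt (w k))%:C ^+ 2 / (x +i* y - (al k)%:C) = A +i* - B.
  by rewrite -weighted_resolvent; apply: eq_bigr => j _; rewrite sqE.
have -> : \sum_j wt j / (x +i* y - lam j) = mean_re rho x y +i* - mean_im rho x y.
  rewrite /mean_re /mean_im hrho; last exact: bounded_re_kernel.
  rewrite hrho; last exact: bounded_im_kernel.
  by rewrite -weighted_resolvent; apply: eq_bigr => j _; rewrite lE rE.
move: (mean_re _ _ _) (mean_im _ _ _) => p q.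
move/eqP; rewrite eq_complex /= => /andP[/eqP e1 /eqP e2].
have N0 : N != 0.
  rewrite /N; apply/negP; rewrite paddr_eq0 ?sqr_ge0// !sqrf_eq0.
  move=> /andP[/eqP h1 /eqP h2]; have A0 : A = 0.
    rewrite e1; have -> : 1 - (c * A - 0 * - B) = 0 by lra.
    have -> : 0 - (c * - B + 0 * A) = 0 by lra.
    by rewrite !mul0r subrr.
  by move: h1; rewrite A0 mulr0 subr0 => /eqP; rewrite oner_eq0.
have m1 := congr1 (fun t => (1 - c * A) * t) e1.
have m2 := congr1 (fun t => (c * B) * t) e2.
have m3 := congr1 (fun t => (c * B) * t) e1.
have m4 := congr1 (fun t => (1 - c * A) * t) e2.
by split; apply: (mulIf N0); rewrite divfK// /N; move: m1 m2 m3 m4 => /=; lra.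
Qed.

End discrete_shift.

Section tails.
Context {R : realType} (rho : borel_prob R) (T : R).
Hypothesis T0 : 0 < T.

Let bounded_ray (S : set (measurableTypeR R)) : measurable S -> bounded_meas (\1_S : R -> R).
Proof.
move=> mS; split; first exact: measurable_indic.
by exists 1 => t; rewrite indicE; case: (_ \in _); rewrite ?normr0 ?normr1.
Qed.

Let mean_ray (S : set (measurableTypeR R)) : measurable S ->
  \int[rho]_t (\1_S t) = fine (rho S).
Proof. by move=> mS; rewrite /Rintegral integral_indic// setIT. Qed.

(** Nonnegative, and at least 1 when |t| >= T: it dominates both tails. *)
Let defect (t : R) : R := 2 * (1 - T * im_kernel 0 T t).

Let bounded_defect : bounded_meas defect.
Proof.
apply: bounded_measZ; apply: bounded_measB; first exact: bounded_meas_cst.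
by apply: bounded_measZ; exact: bounded_im_kernel.
Qed.

Let mean_defect : \int[rho]_t defect t = 2 * (1 - T * mean_im rho 0 T).
Proof.
have bB := bounded_im_kernel 0 T0; have b1 := bounded_meas_cst (1 : R).
rewrite (meanZ rho _ (bounded_measB b1 (bounded_measZ T bB))).
by rewrite (meanB rho b1 (bounded_measZ T bB)) (meanZ rho _ bB) mean_cst.
Qed.

Let defectE t : defect t = 2 * t ^+ 2 / (t ^+ 2 + T ^+ 2).
Proof.
have D0 : 0 < t ^+ 2 + T ^+ 2 by rewrite ltr_wpDl ?sqr_ge0// exprn_gt0.
by rewrite /defect /im_kernel /sqdist sub0r sqrrN; field; rewrite gt_eqF.
Qed.

Let defect_ge0 t : 0 <= defect t.
Proof. by rewrite defectE divr_ge0 ?addr_ge0 ?sqr_ge0// mulr_ge0 ?sqr_ge0. Qed.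

Let defect_ge1 t : T ^+ 2 <= t ^+ 2 -> 1 <= defect t.
Proof.
move=> Tt; have D0 : 0 < t ^+ 2 + T ^+ 2 by rewrite ltr_wpDl ?sqr_ge0// exprn_gt0.
by rewrite defectE ler_pdivlMr//; lra.
Qed.

Lemma left_tail_le :
  fine (rho `]-oo, - T]%classic) <= 2 * (1 - T * mean_im rho 0 T).
Proof.
have mI : measurable (`]-oo, - T]%classic : set (measurableTypeR R)) by [].
rewrite -mean_ray// -mean_defect; apply: mean_le => //; first exact: bounded_ray.
move=> t; rewrite indicE; case: (boolP (t \in _)) => // .
by rewrite inE/= in_itv/= => tT; apply: defect_ge1; have := T0; nra.
Qed.

Lemma right_tail_le :
  1 - fine (rho `]-oo, T]%classic) <= 2 * (1 - T * mean_im rho 0 T).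
Proof.
have mI : measurable (`]-oo, T]%classic : set (measurableTypeR R)) by [].
rewrite -mean_ray// -mean_defect -{1}(mean_cst rho 1) -meanB; last 2 first.
- exact: bounded_meas_cst.
- exact: bounded_ray.
apply: mean_le => //.
  by apply: bounded_measB; [exact: bounded_meas_cst|exact: bounded_ray].
move=> t; rewrite indicE; case: (boolP (t \in _)) => [_|]; first by rewrite subrr.
rewrite notin_setE/= in_itv/= => /negP; rewrite -ltNge subr0 => tT.
by apply: defect_ge1; have := T0; nra.
Qed.

End tails.

Section boolean_shift.
Context {R : realType} (nu : borel_prob R) (c : R).

Let A x y := mean_re nu x y.
Let B x y := mean_im nu x y.
Let N x y := (1 - c * A x y) ^+ 2 + (c * B x y) ^+ 2.
Let A' x y := (A x y - c * (A x y ^+ 2 + B x y ^+ 2)) / N x y.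
Let B' x y := B x y / N x y.

Let N_gt0 x y : 0 < y -> 0 < N x y.
Proof.
move=> y0; have b0 : 0 < B x y by exact: mean_im_gt0.
rewrite lt_neqAle addr_ge0 ?sqr_ge0// andbT eq_sym.
apply/negP; rewrite paddr_eq0 ?sqr_ge0// !sqrf_eq0 mulf_eq0 (gt_eqF b0) orbF.
by move=> /andP[/[swap] /eqP ->]; rewrite mul0r subr0 oner_eq0.
Qed.

Let shifted_approximation : exists rho : nat -> borel_prob R, forall x y, 0 < y ->
  mean_re (rho k) x y @[k --> \oo] --> A' x y /\
  mean_im (rho k) x y @[k --> \oo] --> B' x y.
Proof.
have [m [w [al [w0 w1 cv]]]] := discrete_approximation nu.
have [rho hrho] := choice (fun k => discrete_shift (al k) c (w0 k) (w1 k)).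
exists rho => x y y0.
pose a k := \sum_j w k j * re_kernel x y (al k j).
pose b k := \sum_j w k j * im_kernel x y (al k j).
have ca : a k @[k --> \oo] --> A x y.
  by apply: cv; [exact: continuous_re_kernel|exact: bounded_re_kernel].
have cb : b k @[k --> \oo] --> B x y.
  by apply: cv; [exact: continuous_im_kernel|exact: bounded_im_kernel].
have cc : (fun _ : nat => c) @ \oo --> c by exact: cvg_cst.
have c1 : (fun _ : nat => 1 : R) @ \oo --> (1 : R) by exact: cvg_cst.
have cN : (1 - c * a k) * (1 - c * a k) + (c * b k) * (c * b k) @[k --> \oo] --> N x y.
  rewrite /N !expr2; apply: cvgD; apply: cvgM; try exact: cvgM;
    by apply: cvgB => //; exact: cvgM.
have N0 : N x y != 0 by rewrite gt_eqF// N_gt0.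
have e k : mean_re (rho k) x y = (a k - c * (a k * a k + b k * b k)) /
    ((1 - c * a k) * (1 - c * a k) + (c * b k) * (c * b k)) /\
  mean_im (rho k) x y = b k / ((1 - c * a k) * (1 - c * a k) + (c * b k) * (c * b k)).
  by have [-> ->] := hrho k x y y0; rewrite -!expr2.
split.
  rewrite (funext (fun k => (e k).1)) /A' !expr2; apply: cvgM; last exact: cvgV.
  by apply: cvgB => //; apply: cvgM => //; apply: cvgD; exact: cvgM.
rewrite (funext (fun k => (e k).2)) /B'; apply: cvgM => //; exact: cvgV.
Qed.

(* The shifted transform is asymptotic to 1/z along the imaginary axis, so its
   approximating measures cannot lose mass at infinity. *)
Let shifted_mass : n.+1%:R * B' 0 n.+1%:R @[n --> \oo] --> (1 : R).
Proof.
pose r n : R := n.+1%:R.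
have n0 n : 0 < r n by rewrite /r.
have hA : r n * A 0 (r n) @[n --> \oo] --> (0 : R).
  have -> : (fun n => r n * A 0 (r n)) = (fun n => \int[nu]_t re_kernel 0 1 (t / r n)).
    apply/funext => n; rewrite -(meanZ nu _ (bounded_re_kernel 0 (n0 n))).
    apply: eq_Rintegral => t _.
    rewrite -(re_kernel_scale 0 (t / r n) (n0 n) ltr01) mulr0 mulr1.
    by rewrite (mulrC (r n) (t / r n)) divfK// gt_eqF.
  rewrite [X in _ --> X](_ : _ = re_kernel 0 1 0); last by rewrite /re_kernel subrr mul0r.
  by apply: mean_dilation_cvg; [exact: continuous_re_kernel|exact: bounded_re_kernel].
have hB : r n * B 0 (r n) @[n --> \oo] --> (1 : R).
  have -> : (fun n => r n * B 0 (r n)) = (fun n => \int[nu]_t im_kernel 0 1 (t / r n)).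
    apply/funext => n; rewrite -(meanZ nu _ (bounded_im_kernel 0 (n0 n))).
    apply: eq_Rintegral => t _.
    rewrite -(im_kernel_scale 0 (t / r n) (n0 n) ltr01) mulr0 mulr1.
    by rewrite (mulrC (r n) (t / r n)) divfK// gt_eqF.
  rewrite [X in _ --> X](_ : _ = im_kernel 0 1 0); last first.
    by rewrite /im_kernel /sqdist subrr expr0n/= add0r expr1n divr1.
  by apply: mean_dilation_cvg; [exact: continuous_im_kernel|exact: bounded_im_kernel].
have cr : (r n)^-1 @[n --> \oo] --> (0 : R) by exact: cvg_harmonic.
have cc : (fun _ : nat => c) @ \oo --> c by exact: cvg_cst.
have c1 : (fun _ : nat => 1 : R) @ \oo --> (1 : R) by exact: cvg_cst.
have cA : A 0 (r n) @[n --> \oo] --> (0 : R).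
  have -> : (fun n => A 0 (r n)) = (fun n => (r n)^-1 * (r n * A 0 (r n))).
    by apply/funext => n; rewrite mulrA mulVf ?mul1r// gt_eqF.
  by rewrite -[X in _ --> X](mulr0 (0 : R)); exact: cvgM.
have cB : B 0 (r n) @[n --> \oo] --> (0 : R).
  have -> : (fun n => B 0 (r n)) = (fun n => (r n)^-1 * (r n * B 0 (r n))).
    by apply/funext => n; rewrite mulrA mulVf ?mul1r// gt_eqF.
  by rewrite -[X in _ --> X](mul0r (1 : R)); exact: cvgM.
have cN : N 0 (r n) @[n --> \oo] --> (1 - c * 0) * (1 - c * 0) + (c * 0) * (c * 0).
  rewrite /N; under eq_fun do rewrite !expr2.
  apply: cvgD; apply: cvgM; try exact: cvgM;
    by apply: cvgB => //; exact: cvgM.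
rewrite !mulr0 subr0 mulr1 addr0 in cN.
have -> : (fun n : nat => n.+1%:R * B' 0 n.+1%:R) = (fun n => (r n * B 0 (r n)) / N 0 (r n)).
  by apply/funext => n; rewrite /B' mulrA.
rewrite -[X in _ --> X](divr1 (1 : R)); apply: cvgM => //; apply: cvgV => //.
Qed.

(** The measure obtained is the Boolean convolution of nu with the Dirac measure
    at c.  Discrete approximations of it form a tight sequence because the
    limit of their transforms is asymptotic to 1/z, and its weak limits have the
    required transform. *)
Lemma boolean_shift_exists : exists rho : borel_prob R, forall x y, 0 < y ->
  re_recip rho x y = re_recip nu x y - c /\ im_recip rho x y = im_recip nu x y.
Proof.
have [rho hrho] := shifted_approximation.
have tight (e : R) : 0 < e -> exists T : R, \forall k \near \oo,
     fine (rho k `]-oo, - T]%classic) < e /\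
     1 - e < fine (rho k `]-oo, T]%classic).
  move=> e0.
  have : \forall n \near \oo, 1 - e / 2 < n.+1%:R * B' 0 n.+1%:R.
    by apply: cvgr_gt shifted_mass _ _; lra.
  move=> /filter_ex[n hn]; exists n.+1%:R; set T : R := n.+1%:R in hn *.
  have T0 : 0 < T by rewrite /T.
  have : T * mean_im (rho k) 0 T @[k --> \oo] --> T * B' 0 T.
    by apply: cvgM; [exact: cvg_cst|exact: (hrho 0 T T0).2].
  move=> /cvgr_gt /(_ _ hn); apply: filterS => k hk.
  have h1 := left_tail_le (rho k) T0; have h2 := right_tail_le (rho k) T0.
  split; lra.
have [s [rho0 [hs hrho0]]] := tight_subsequence tight.
have s_oo : s k @[k --> \oo] --> \oo.
  apply/cvgnyPge => m; near=> k; apply: leq_trans (hs k).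
  by near: k; exact: nbhs_infty_ge.
have reE x y : 0 < y -> mean_re rho0 x y = A' x y.
  move=> y0; have h1 := hrho0 _ (@continuous_re_kernel _ x y y0) (bounded_re_kernel x y0).
  have h2 := cvg_comp _ _ s_oo (hrho x y y0).1.
  exact: (cvg_unique _ h1 h2).
have imE x y : 0 < y -> mean_im rho0 x y = B' x y.
  move=> y0; have h1 := hrho0 _ (@continuous_im_kernel _ x y y0) (bounded_im_kernel x y0).
  have h2 := cvg_comp _ _ s_oo (hrho x y y0).2.
  exact: (cvg_unique _ h1 h2).
exists rho0 => x y y0.
have n0 := N_gt0 x y0; have D0 := abs2_cauchy_gt0 nu x y0.
rewrite /re_recip /im_recip.
have -> : abs2_cauchy rho0 x y = abs2_cauchy nu x y / N x y.
  rewrite /abs2_cauchy reE// imE// /A' /B'.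
  move: n0; rewrite /N /A /B; move: (mean_re _ _ _) (mean_im _ _ _) => p q n0.
  by field; rewrite gt_eqF.
rewrite reE// imE// /A' /B'; move: n0 D0; rewrite /abs2_cauchy /A /B.
move: (N x y) (mean_re _ _ _) (mean_im _ _ _) => n p q n0 D0.
by split; field; rewrite !gt_eqF.
Unshelve. all: by end_near. Qed.

End boolean_shift.

(** * Which subordination function is unbounded *)

Section dichotomy.
Context {R : realType} (mu : borel_prob R) (a b : R).
Hypothesis hab : a < b.
Hypothesis ha : (0 < mu [set a])%E.
Hypothesis hsum : (mu [set a] + mu `[b, +oo[%classic = 1)%E.
Hypothesis hlim : real_cauchy_transform mu x @[x --> b^'-] --> (0 : R).
Context (nu1 nu2 : borel_prob R).
Hypothesis re_sum : forall x y, 0 < y ->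
  re_recip nu1 x y + re_recip nu2 x y = x + re_recip mu x y.
Hypothesis im_sum : forall x y, 0 < y ->
  im_recip nu1 x y + im_recip nu2 x y = y + im_recip mu x y.

Let linear (nu : borel_prob R) := forall x2, a < x2 -> x2 < b ->
  exists2 C : R, 0 < C & forall x y : R, x <= x2 -> 0 < y -> im_recip nu x y <= C * y.

(** Each imaginary part is at least y, so each is at most that of F. *)
Lemma im_summand_le : linear nu1 /\ linear nu2.
Proof.
split=> x2 ax2 x2b; have [C C0 hC] := im_recip_le hab ha hsum hlim ax2 x2b;
  exists C => // x y xx2 y0; have := hC x y xx2 y0; have := im_sum x y0.
  by have := im_recip_ge nu2 x y0; lra.
by have := im_recip_ge nu1 x y0; lra.
Qed.

Let unbounded_at (nu : borel_prob R) (M : R) := exists x y0 : R,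
  [/\ a < x, x < b, 0 < y0 & forall y : R, 0 < y -> y <= y0 -> M < re_recip nu x y].


Let unbounded_or M : unbounded_at nu1 M \/ unbounded_at nu2 M.
Proof.
have [x [y0 [ax xb y00 hy0]]] := re_recip_near_ray hab ha hsum hlim (2 * M + 2 - a).
have [L1 L2] := im_summand_le.
have [C1 C10 hC1] := L1 x ax xb; have [C2 C20 hC2] := L2 x ax xb.
pose C := C1 + C2; have C0 : 0 < C by rewrite /C; lra.
pose y1 := Num.min y0 C^-1.
have y10 : 0 < y1 by rewrite lt_min y00 invr_gt0.
have Cy1 : C * y1 <= 1.
  by rewrite -ler_pdivlMl// mulr1 ge_min lexx orbT.
have far (nu : borel_prob R) : (forall y : R, 0 < y -> im_recip nu x y <= C * y) ->
    M + 1 < re_recip nu x y1 -> unbounded_at nu M.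
  move=> hC h; exists x, y1; split=> // y yp yy1.
  have := re_recip_lipschitz yp y10 (hC y yp) (hC y1 y10).
  rewrite subrr normr0 add0r ler_distl => /andP[h1 _].
  have : 0 < C * y by rewrite mulr_gt0.
  by move: h1; rewrite distrC ger0_norm ?subr_ge0//; nra.
have s := re_sum x y10.
have := hy0 y1 y10 (ltac:(by rewrite ge_min lexx)).
have [h|h] := ltP (M + 1) (re_recip nu1 x y1).
  move=> _; left; apply: far => // y yp; have := hC1 x y (lexx x) yp.
  have : 0 < C2 * y by rewrite mulr_gt0.
  rewrite /C; lra.
move=> h'; right; apply: far; last by lra.
move=> y yp; have := hC2 x y (lexx x) yp.
have : 0 < C1 * y by rewrite mulr_gt0.
rewrite /C; lra.
Qed.

(** The sum is unbounded near b, so for each bound one of the two exceeds it; since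
    exceeding a bound is hereditary downwards, the same one does so for all of
    them.  By the Lipschitz estimate it is enough to be large at one small
    height. *)
Lemma unbounded_summand :
  (forall M, unbounded_at nu1 M) \/ (forall M, unbounded_at nu2 M).
Proof.
have mono nu M M' : M <= M' -> unbounded_at nu M' -> unbounded_at nu M.
  move=> MM' [x [y0 [ax xb y00 h]]]; exists x, y0; split=> // y yp yy0.
  exact: le_lt_trans MM' (h y yp yy0).
have [h1|n1] := pselect (forall M, unbounded_at nu1 M); first by left.
right => M; move/existsNP : n1 => [M1 n1].
have [h|h] := unbounded_or (Num.max M M1).
  by exfalso; apply: n1; apply: mono h; rewrite le_max lexx orbT.
by apply: mono h; rewrite le_max lexx.
Qed.

End dichotomy.

Section dirac_transform.
Context {R : realType}.
Local Open Scope complex_scope.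

Lemma mean_dirac (c : R) (h : R -> R) : measurable_fun setT h ->
  \int[dirac_law c]_t h t = h c.
Proof.
move=> mh; rewrite /Rintegral integral_dirac//; first by rewrite diracT mul1e.
exact/measurable_EFinP.
Qed.

Lemma recip_cauchy_dirac (nu : borel_prob R) (c x y : R) : 0 < y ->
  same_law nu (dirac_law c) -> recip_cauchy nu (x +i* y) = x +i* y - c%:C.
Proof.
move=> y0 nuc.
have E h : bounded_meas h -> \int[nu]_t h t = h c.
  move=> bh; rewrite -(mean_dirac c bh.1) /Rintegral; congr fine.
  by apply: eq_measure_integral => A mA _; exact: nuc.
rewrite recip_cauchyE// /re_recip /im_recip /abs2_cauchy /mean_re /mean_im.
rewrite !E; [|exact: bounded_im_kernel|exact: bounded_re_kernel].
have D0 := sqdist_gt0 x c y0.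
apply/eqP; rewrite eq_complex /= subr0 /re_kernel /im_kernel; move: D0; rewrite /sqdist => D0.
by apply/andP; split; apply/eqP; field; rewrite !gt_eqF.
Qed.

Lemma recip_cauchy_inj (mu nu : borel_prob R) (x y x' y' : R) : 0 < y -> 0 < y' ->
  recip_cauchy mu (x +i* y) = recip_cauchy nu (x' +i* y') ->
  mean_im mu x y = mean_im nu x' y'.
Proof.
move=> y0 y0' /invr_inj; rewrite !cauchy_transformE//.
by move/eqP; rewrite eq_complex /= => /andP[_]; rewrite eqr_opp => /eqP.
Qed.

End dirac_transform.

(** * Indecomposability *)

Lemma dirac_not_two_atoms {R : realType} (mu : borel_prob R) (a b : R) :
  a < b -> (0 < mu [set a])%E -> (0 < mu `[b, +oo[%classic)%E -> ~ is_dirac mu.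
Proof.
move=> hab ha hb [c mc].
have ca : c = a.
  move: ha; rewrite mc; last exact: measurable_set1.
  rewrite /dirac_law /= diracE; case: (boolP (c \in _)); last by rewrite ltxx.
  by rewrite inE.
have bc : b <= c.
  move: hb; rewrite mc//.
  rewrite /dirac_law /= diracE; case: (boolP (c \in _)); last by rewrite ltxx.
  by rewrite inE/= in_itv/= andbT.
by move: hab; rewrite -ca ltNge bc.
Qed.

Section translate.
Local Open Scope complex_scope.

(** If the cofactor is a Dirac measure at c, the factor is a translate, hence an
    improper factor.  The subordination functions of mu and the Dirac measure at
    - c are z + c, the reciprocal transform of the Dirac measure at - c, and the
    reciprocal transform of nu minus c, for which the Boolean shift is needed. *)
Lemma translate_improper {R : realType} (mu nu mu2 : borel_prob R) (c : R)
    (Z1 Z2 : R[i] -> R[i]) :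
  same_law mu2 (dirac_law c) -> recip_cauchy_class Z2 ->
  (forall z, upper_half_plane z ->
    [/\ z = Z1 z + Z2 z - recip_cauchy nu (Z1 z),
        recip_cauchy nu (Z1 z) = recip_cauchy mu2 (Z2 z) &
        recip_cauchy mu z = recip_cauchy nu (Z1 z)]) ->
  is_free_conv mu (dirac_law (- c)) nu.
Proof.
move=> mu2c [nu2 hZ2] H.
have muE z : upper_half_plane z -> recip_cauchy mu z = recip_cauchy nu (z - c%:C).
  move=> hz; have [e1 e2 e3] := H z hz; rewrite e3; congr recip_cauchy.
  have Z2c : recip_cauchy mu2 (Z2 z) = Z2 z - c%:C.
    rewrite hZ2//; case: z hz {e1 e2 e3} => x y /= y0.
    rewrite recip_cauchyE//; apply: recip_cauchy_dirac mu2c.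
    exact: im_recip_gt0.
  rewrite {2}e1 e2 Z2c; ring.
have [rho hrho] := boolean_shift_exists nu c.
have rhoE z : upper_half_plane z -> recip_cauchy rho z = recip_cauchy nu z - c%:C.
  case: z => x y /= y0; rewrite !recip_cauchyE//.
  have [-> ->] := hrho x y y0.
  by apply/eqP; rewrite eq_complex /= subr0 !eqxx.
have up z : upper_half_plane z -> upper_half_plane (z + c%:C).
  by case: z => x y; rewrite /upper_half_plane /= addr0.
exists (fun z => z + c%:C), (recip_cauchy rho); split.
- exists (dirac_law (- c)) => -[x y] /= y0.
  rewrite (recip_cauchy_dirac (c := - c))//.
  by rewrite rmorphN opprK.
- by exists rho.
move=> z hz.
have e : recip_cauchy mu (z + c%:C) = recip_cauchy nu z.
  by rewrite muE ?addrK//; exact: up.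
rewrite e rhoE//; split=> //; first by ring.
rewrite -rhoE//; case: z hz {e} => x y /= y0.
rewrite recip_cauchyE// recip_cauchyE//.
rewrite (recip_cauchy_dirac (c := - c))//; last exact: im_recip_gt0.
have [-> ->] := hrho x y y0.
by apply/eqP; rewrite eq_complex /= oppr0 addr0 opprK subrK !eqxx.
Qed.

End translate.

Unset Implicit Arguments.
Set Strict Implicit.

Theorem theorem8p1 (R : realType) (mu : borel_prob R) (a b : R)
  (hab : a < b)
  (ha : (0 < mu [set a])%E)
  (hb : (0 < mu `[b, +oo[%classic)%E)
  (hsum : (mu [set a] + mu `[b, +oo[%classic = 1)%E)
  (hlim : real_cauchy_transform mu x @[x --> b^'-] --> (0 : R)) :
  indecomposable mu.
Proof.
split; first exact: dirac_not_two_atoms hab ha hb.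
move=> nu [mu2 [Z1 [Z2 [[nu1 hZ1] hZ2' H]]]]; have [nu2 hZ2] := hZ2'.
have upE (x y : R) : 0 < y -> upper_half_plane (x +i* y)%C by [].
have recip_in (m : borel_prob R) (x y : R) : 0 < y -> 0 < im_recip m x y.
  by move=> y0; exact: im_recip_gt0.
have eqs (x y : R) : 0 < y ->
    [/\ re_recip nu1 x y + re_recip nu2 x y = x + re_recip mu x y,
        im_recip nu1 x y + im_recip nu2 x y = y + im_recip mu x y,
        mean_im nu (re_recip nu1 x y) (im_recip nu1 x y) = mean_im mu x y &
        mean_im mu2 (re_recip nu2 x y) (im_recip nu2 x y) = mean_im mu x y].
  move=> y0; have hz := upE x y y0; have [e1 e2 e3] := H _ hz.
  rewrite hZ1// hZ2// !recip_cauchyE ?recip_in// in e1 e2 e3.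
  split.
  - move/eqP : e1; rewrite -e3 eq_complex /= => /andP[/eqP h _].
    lra.
  - move/eqP : e1; rewrite -e3 eq_complex /= => /andP[_ /eqP h].
    lra.
  - apply: (recip_cauchy_inj (recip_in nu1 x y y0) y0).
    by rewrite !recip_cauchyE ?recip_in// e3.
  - apply: (recip_cauchy_inj (recip_in nu2 x y y0) y0).
    by rewrite !recip_cauchyE ?recip_in// e3 e2.
have re_sum : forall x y : R, 0 < y ->
    re_recip nu1 x y + re_recip nu2 x y = x + re_recip mu x y.
  by move=> x y y0; have [] := eqs x y y0.
have im_sum : forall x y : R, 0 < y ->
    im_recip nu1 x y + im_recip nu2 x y = y + im_recip mu x y.
  by move=> x y y0; have [] := eqs x y y0.
have [L1 L2] := im_summand_le hab ha hsum hlim im_sum.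
have [U1|U2] := unbounded_summand hab ha hsum hlim re_sum im_sum.
  have [c nuc] : exists c, same_law nu (dirac_law c).
    apply: (subordinated_dirac hab hsum _ L1 U1) => x y y0.
    by have [] := eqs x y y0.
  by exists c; left.
have [c mu2c] : exists c, same_law mu2 (dirac_law c).
  apply: (subordinated_dirac hab hsum _ L2 U2) => x y y0.
  by have [] := eqs x y y0.
by exists (- c); right; exact: translate_improper mu2c hZ2' H.
Qed.
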